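(* Let $\mathcal{A}$ be a unital $C^*$-algebra with unit $I$, and let $$\mathcal{A}_+:=\{W\in\mathcal{A}\mid \operatorname{Re} W\geq \varepsilon I \text{ for some } \varepsilon>0\}.$$ Let $\eta:\mathcal{A}_+\to\mathcal{A}_+$ be a holomorphic (analytic) map which is bounded on bounded subsets of $\mathcal{A}_+$, i.e. $\sup\{\|\eta(W)\|\mid W\in\mathcal{A}_+,\ \|W\|\leq r\}<\infty$ for every $r>0$. Fix $V\in\mathcal{A}_+$. Then the equation $$VW+\eta(W)W=I$$ has exactly one solution $W\in\mathcal{A}_+$. Moreover, for every $W_0\in\mathcal{A}_+$ the iterates $W_n:=\mathcal{F}_V^n(W_0)$, where $\mathcal{F}_V(W):=[V+\eta(W)]^{-1}$, are well defined and converge in norm to this solution $W$. Furthermore, $$\|W\|\leq \|(\operatorname{Re} V)^{-1}\| \quad\text{and}\quad \operatorname{Re} W\geq \frac{1}{m^2\,\|(\operatorname{Re} V)^{-1}\|}\, I,$$ where $$m:=\|V\|+\sup\{\|\eta(W')\|\mid W'\in\mathcal{A}_+,\ \|W'\|\leq \|(\operatorname{Re} V)^{-1}\|\}.$$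
   Context: For an element $W$ of a $C^*$-algebra, $\operatorname{Re} W:=\frac12(W+W^* )$ and $\operatorname{Im} W:=\frac1{2i}(W-W^* )$. For a selfadjoint $A$, $A\geq 0$ means the spectrum of $A$ is contained in $[0,\infty)$, and $A\geq B$ means $A-B\geq 0$. Note $W\in\mathcal{A}_+$ iff $\operatorname{Re}W\geq 0$ and $\operatorname{Re} W$ is invertible. *)

(* Defs.v *)
From HB Require Import structures.
From mathcomp Require Import all_boot all_order all_algebra.
From mathcomp Require Import all_classical all_reals all_analysis.
From mathcomp Require Import complex.
Import Order.TTheory GRing.Theory Num.Theory.
Import numFieldNormedType.Exports.
Set Implicit Arguments. Unset Strict Implicit. Unset Printing Implicit Defensive.
Local Open Scope ring_scope.
Local Open Scope classical_set_scope.

Section CStar.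
Variable R : realType.
Variable A : completeNormedModType R[i].
Variables (mul : A -> A -> A) (one : A) (star : A -> A).

Record unital_cstar_algebra : Prop := {
  cs_mulA : forall a b c, mul a (mul b c) = mul (mul a b) c;
  cs_mulDl : forall a b c, mul (a + b) c = mul a c + mul b c;
  cs_mulDr : forall a b c, mul a (b + c) = mul a b + mul a c;
  cs_mulZl : forall (k : R[i]) a b, mul (k *: a) b = k *: mul a b;
  cs_mulZr : forall (k : R[i]) a b, mul a (k *: b) = k *: mul a b;
  cs_mul1l : forall a, mul one a = a;
  cs_mul1r : forall a, mul a one = a;
  cs_one_neq0 : one != 0;
  cs_starD : forall a b, star (a + b) = star a + star b;
  cs_starZ : forall (k : R[i]) a, star (k *: a) = conjc k *: star a;
  cs_starK : forall a, star (star a) = a;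
  cs_starM : forall a b, star (mul a b) = mul (star b) (star a);
  cs_norm_mul : forall a b, `|mul a b| <= `|a| * `|b|;
  cs_cstar : forall a, `|mul (star a) a| = `|a| ^+ 2
}.

Definition is_inverse (a b : A) : Prop := mul a b = one /\ mul b a = one.
Definition invertible (a : A) : Prop := exists b, is_inverse a b.
Definition ainv (a : A) : A := xget a [set b | is_inverse a b].

Definition spectrum (a : A) : set (R[i]) :=
  [set l | ~ invertible (a - l *: one)].

Definition ReA (W : A) : A := (2%:R : R[i])^-1 *: (W + star W).

Definition selfadjoint (a : A) : Prop := star a = a.

(* a >= 0 : a selfadjoint with spectrum in [0, oo)  (0 <= l in C means l real, l >= 0) *)
Definition cpos (a : A) : Prop := selfadjoint a /\ (forall l, spectrum a l -> 0 <= l).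

Definition cge (a b : A) : Prop := cpos (a - b).

Definition Aplus : set A :=
  [set W | exists eps : R, 0 < eps /\ cge (ReA W) ((eps%:C)%C *: one)].

Definition nrm (x : A) : R := complex.Re `|x|.

End CStar.

(* Main.v *)
(** A fixed point of [F W = [V + eta W]^-1] is a solution.  [F] maps the bounded
    convex set [D] of all [W] in [A_+] with [|W| < r] into a convex set [S] lying
    at positive distance from the complement of [D]: with
    [rho = |(Re V)^-1|], [U = V + eta W] satisfies [Re U >= 1/rho], hence
    [|U^-1| <= rho] and [Re U^-1 >= 1/(rho |U|^2)].  By the argument of Earle and
    Hamilton, the derivatives of the iterates [F^n] decay geometrically on [S], so
    that [F^n] is eventually a contraction.  The complex analysis needed is a
    Cauchy estimate for vector-valued functions that are merely differentiable
    at each point; it comes from Goursat's subdivision argument applied to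
    Riemann sums.  On the C*-algebra side, [Re W >= e] is equivalent to
    [|c - W|^2 <= c^2 - 2 c e + O(1)] for real [c >= 0], a condition that is
    visibly stable under sums and yields [|W^-1| <= 1/e] by a Neumann series. *)
Require Import Defs.
From HB Require Import structures.
From mathcomp Require Import all_boot all_order all_algebra.
From mathcomp Require Import all_classical all_reals all_analysis.
From mathcomp Require Import complex ring lra.
Import Order.TTheory GRing.Theory Num.Theory.
Import numFieldNormedType.Exports.
Local Open Scope ring_scope.
Local Open Scope classical_set_scope.

Set Implicit Arguments. Unset Strict Implicit. Unset Printing Implicit Defensive.

(** [F] need not contract the norm; only high iterates do, and only on a bounded domain. The radius
    [r > rho] is therefore left free: chosen large enough to catch given points, it turns
    contraction on a bounded domain into global uniqueness and convergence. Convexity of [S]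
    replaces the invariant metric usual in the Earle-Hamilton theorem, since bounds on derivatives
    can be integrated along segments. On the algebra side the obstacle is that the order is defined
    by spectra, for which even sums of positive elements are not evidently positive. The bridge to
    the norm is that a selfadjoint [b] of norm 1 has 1 or -1 in its spectrum, which follows from the
    same Cauchy estimate applied to resolvents. The norm condition for [Re W >= e] comes from
    [|c - W|^2 = |c^2 - 2 c Re W + W^* W|]: the coefficient of [c] records the lower bound, and the
    O(1) term absorbs [W^* W]. *)

Section Norms.
Variable R : realType.

(** * Norms with values in [R], and geometric convergence *)

Definition cabs (z : R[i]) : R := complex.Re `|z|.

Lemma cabsE (z : R[i]) : `|z| = (cabs z)%:C%C.
Proof. by rewrite /cabs normc_def. Qed.

Lemma cabs_ge0 z : 0 <= cabs z.
Proof. by have := normr_ge0 z; rewrite cabsE lecR. Qed.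

Lemma cabsM x y : cabs (x * y) = cabs x * cabs y.
Proof. by apply: complexI; rewrite rmorphM /= -!cabsE normrM. Qed.

Lemma cabsD x y : cabs (x + y) <= cabs x + cabs y.
Proof. by rewrite -lecR rmorphD /= -!cabsE ler_normD. Qed.

Lemma cabsN x : cabs (- x) = cabs x.
Proof. by rewrite /cabs normrN. Qed.

Lemma cabs_real (x : R) : cabs x%:C%C = `|x|.
Proof. by rewrite /cabs normc_def /= expr0n addr0 sqrtr_sqr. Qed.

Lemma cabs_i : cabs 'i%C = 1.
Proof. by rewrite /cabs normc_def /= expr0n add0r expr1n sqrtr1. Qed.

Lemma cabs1 : cabs 1 = 1.
Proof. by rewrite /cabs normr1. Qed.

Lemma cabsX x n : cabs (x ^+ n) = cabs x ^+ n.
Proof. by elim: n => [|n IH]; rewrite ?expr0 ?cabs1 // !exprS cabsM IH. Qed.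

Lemma cabs_eq0 x : (cabs x == 0) = (x == 0).
Proof. by rewrite -(inj_eq (@complexI R)) -cabsE normr_eq0. Qed.

Lemma cabs_gt0 x : (0 < cabs x) = (x != 0).
Proof. by rewrite lt0r cabs_ge0 andbT cabs_eq0. Qed.

Lemma cabsV x : cabs x^-1 = (cabs x)^-1.
Proof. by apply: complexI; rewrite -cabsE normfV cabsE fmorphV. Qed.

Lemma Re_le_cabs x : `|complex.Re x| <= cabs x.
Proof. by have := normc_ge_Re x; rewrite cabsE lecR. Qed.

Lemma Im_le_cabs x : `|complex.Im x| <= cabs x.
Proof.
have := Re_le_cabs (x * 'i%C); rewrite ReiNIm normrN.
by rewrite cabsM cabs_i mulr1.
Qed.

Lemma cabs_le_ReIm x : cabs x <= `|complex.Re x| + `|complex.Im x|.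
Proof.
rewrite [x in cabs x]complexE (le_trans (cabsD _ _))// cabsM cabs_i mul1r.
by rewrite !cabs_real.
Qed.

Variable E : completeNormedModType R[i].
Implicit Types x y : E.

(** The norm lives in [R[i]] but is real, so [nrm] loses nothing; this transports inequalities to
    [R], where [lra] and [nra] apply. *)
Lemma nrmE x : `|x| = (nrm x)%:C%C.
Proof.
have : `|x| \is Num.real by apply: normr_real.
by move=> /RRe_real <-; rewrite /nrm.
Qed.

Lemma nrm_ge0 x : 0 <= nrm x.
Proof. by have := normr_ge0 x; rewrite nrmE lecR. Qed.

Lemma nrmD x y : nrm (x + y) <= nrm x + nrm y.
Proof. by rewrite -lecR rmorphD /= -!nrmE ler_normD. Qed.

Lemma nrmN x : nrm (- x) = nrm x.
Proof. by rewrite /nrm normrN. Qed.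

Lemma nrm_subC x y : nrm (x - y) = nrm (y - x).
Proof. by rewrite -nrmN opprB. Qed.

Lemma nrmB x y : nrm (x - y) <= nrm x + nrm y.
Proof. by rewrite -(nrmN y) nrmD. Qed.

Lemma nrm0 : nrm (0 : E) = 0.
Proof. by rewrite /nrm normr0. Qed.

Lemma nrm_eq0 x : (nrm x == 0) = (x == 0).
Proof. by rewrite -(inj_eq (@complexI R)) -nrmE normr_eq0. Qed.

Lemma nrm_gt0 x : (0 < nrm x) = (x != 0).
Proof. by rewrite lt0r nrm_ge0 andbT nrm_eq0. Qed.

Lemma nrmZ k x : nrm (k *: x) = cabs k * nrm x.
Proof. by apply: complexI; rewrite rmorphM /= -nrmE -cabsE -nrmE normrZ. Qed.

Lemma nrmZr (k : R) x : 0 <= k -> nrm (k%:C%C *: x) = k * nrm x.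
Proof. by move=> k0; rewrite nrmZ cabs_real ger0_norm. Qed.

Lemma nrm_sum (I : Type) (r : seq I) (P : pred I) (F : I -> E) :
  nrm (\sum_(i <- r | P i) F i) <= \sum_(i <- r | P i) nrm (F i).
Proof.
elim: r => [|i r IH]; first by rewrite !big_nil nrm0.
rewrite !big_cons; case: ifP => // _.
by rewrite (le_trans (nrmD _ _))// lerD2l.
Qed.

Lemma nrm_sum_ord n (F : 'I_n -> E) (B : R) :
  (forall i, nrm (F i) <= B) -> nrm (\sum_i F i) <= n%:R * B.
Proof.
move=> FB; apply: (le_trans (nrm_sum _ _ _)).
rewrite (le_trans (ler_sum _ (fun i _ => FB i)))//.
by rewrite big_const_ord iter_addr_0 mulr_natl.
Qed.

Lemma pos_realC (e : R[i]) : 0 < e -> exists2 d : R, 0 < d & e = d%:C%C.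
Proof.
case: e => a b; rewrite ltcE /= => /andP[/eqP b0 a0].
by exists a => //; rewrite b0.
Qed.

Lemma cvg_nrmP (u : nat -> E) (l : E) :
  (forall e : R, 0 < e -> exists N, forall n, (N <= n)%N -> nrm (u n - l) < e) ->
  u @ \oo --> l.
Proof.
move=> H; apply/cvgrPdist_lt => e /pos_realC[d d0 ->].
have [N HN] := H d d0; exists N => // n /= /HN.
by rewrite nrm_subC nrmE ltcR.
Qed.

Lemma nrm_ge_contra x (c : R) : (forall e, 0 < e -> nrm x <= c + e) -> nrm x <= c.
Proof. by move=> H; apply/ler_addgt0Pr. Qed.

Lemma nrm_sub_small x y : (forall e, 0 < e -> nrm (x - y) <= e) -> x = y.
Proof.
move=> H; apply/eqP; rewrite -subr_eq0 -nrm_eq0 eq_le nrm_ge0 andbT.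
by apply/ler_addgt0Pr => e /H; rewrite add0r.
Qed.

Lemma geometric_small (q C e : R) : 0 <= q < 1 -> 0 < e ->
  exists N, forall n, (N <= n)%N -> C * q ^+ n < e.
Proof.
move=> /andP[q0 q1] e0.
have qn : `|q| < 1 by rewrite ger0_norm.
have /cvgrPdist_lt /(_ e e0) [N _ HN] : (fun n => C * q ^+ n) @ \oo --> (0 : R).
  by rewrite -[X in _ --> X](mulr0 C); apply: cvgMr; apply: cvg_expr.
exists N => n /HN; rewrite sub0r normrN => H.
exact: le_lt_trans (ler_norm _) H.
Qed.

Lemma geometric_steps (u : nat -> E) (C q : R) : 0 <= C -> 0 <= q < 1 ->
  (forall n, nrm (u n.+1 - u n) <= C * q ^+ n) ->
  exists l, forall e : R, 0 < e ->
    exists N, forall n, (N <= n)%N -> nrm (u n - l) < e.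
Proof.
move=> C0 q01 H; have /andP[q0 q1] := q01.
have D n p : nrm (u (n + p)%N - u n) <= C / (1 - q) * q ^+ n.
  (* With the exact partial geometric sum the induction on [p] closes with equality. *)
  have : nrm (u (n + p)%N - u n) <= C / (1 - q) * (q ^+ n - q ^+ (n + p)).
    elim: p => [|p IH]; first by rewrite addn0 !subrr nrm0 mulr0.
    rewrite addnS -(subrK (u (n + p)%N) (u _.+1)) -addrA.
    apply: (le_trans (nrmD _ _)); apply: (le_trans (lerD (H _) IH)).
    rewrite exprS le_eqVlt; apply/orP; left; apply/eqP; field.
    by rewrite subr_eq0 eq_sym lt_eqF.
  move=> /le_trans; apply; apply: ler_wpM2l.
    by rewrite divr_ge0 // subr_ge0 ltW.
  by rewrite gerBl exprn_ge0.
have : cauchy (u @ \oo).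
  apply: cauchy_exP => e /pos_realC[d d0 ->].
  have [N HN] := geometric_small (C / (1 - q)) q01 d0.
  exists (u N); exists N => // n /= Nn; rewrite -ball_normE /= nrmE ltcR nrm_subC.
  by rewrite -(subnKC Nn) (le_lt_trans (D _ _))// HN.
move=> /cauchy_cvgP ul; exists (lim (u @ \oo)) => e e0.
have /cvgrPdist_lt/(_ e%:C%C) := ul; rewrite ltcR => /(_ e0) [N _ HN].
by exists N => n /HN /=; rewrite nrmE ltcR nrm_subC.
Qed.

End Norms.

(* [P a b s] speaks of the square [a, a + s] x [b, b + s]. *)
Lemma square_induction (R : realType) (P : R -> R -> R -> Prop) (a b s : R) :
  0 < s ->
  (forall a b s, 0 < s ->
    (forall i j : 'I_3, P (a + i%:R * (s / 3)) (b + j%:R * (s / 3)) (s / 3)) ->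
    P a b s) ->
  (forall u v, a <= u <= a + s -> b <= v <= b + s ->
    exists2 d : R, 0 < d & forall a' b' s', 0 < s' < d ->
      a' <= u <= a' + s' -> b' <= v <= b' + s' -> P a' b' s') ->
  P a b s.
Proof.
move=> s0 glue loc; apply: contrapT => nP.
(* A failing square has a failing cell among its nine. Iterating gives nested failing squares that
   shrink to a point, where [loc] is contradicted. *)
pose T := {q : R * R * R | 0 < q.2 /\ ~ P q.1.1 q.1.2 q.2}.
have step (q : T) : {q' : T | exists i j : 'I_3, sval q' =
    ((sval q).1.1 + i%:R * ((sval q).2 / 3),
     (sval q).1.2 + j%:R * ((sval q).2 / 3), (sval q).2 / 3)}.
  apply: cid; case: q => [[[x y] r] /= [r0 nPr]].
  have : ~ forall i j : 'I_3, P (x + i%:R * (r / 3)) (y + j%:R * (r / 3)) (r / 3).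
    by move=> /(glue _ _ _ r0).
  move=> /existsNP[i /existsNP[j nPij]].
  have r30 : 0 < r / 3 by rewrite divr_gt0.
  by exists (exist _ (x + i%:R * (r / 3), y + j%:R * (r / 3), r / 3) (conj r30 nPij)); exists i, j.
pose q n : T := iter n (fun q => sval (step q)) (exist _ (a, b, s) (conj s0 nP)).
pose r n := (sval (q n)).2.
have rS n : r n.+1 = r n / 3.
  by rewrite /r /=; have [i [j ->]] := svalP (step (q n)).
have r0 n : 0 < r n by have [] := svalP (q n).
have nest (f : R * R * R -> R) (c : R) : f (a, b, s) = c ->
    (forall n, exists i : 'I_3, f (sval (q n.+1)) = f (sval (q n)) + i%:R * (r n / 3)) ->
    exists u, forall n, f (sval (q n)) <= u <= f (sval (q n)) + r n.
  move=> fc fS; pose x n := f (sval (q n)).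
  have xS n : x n <= x n.+1 /\ x n.+1 + r n.+1 <= x n + r n.
    have [i iE] := fS n; rewrite /x iE rS.
    have i2 : (i%:R : R) <= 2 by rewrite ler_nat -ltnS.
    have i0 : 0 <= (i%:R : R) by [].
    have := r0 n => rn; split; nra.
  have xle n m : x n <= x (n + m)%N /\ x (n + m)%N + r (n + m)%N <= x n + r n.
    elim: m => [|m [IH1 IH2]]; first by rewrite addn0.
    by rewrite addnS; have [X1 X2] := xS (n + m)%N; split;
      [exact: le_trans IH1 X1 | exact: le_trans X2 IH2].
  have xub n m : x m <= x n + r n.
    have [nm|/ltnW mn] := leqP n m.
      have [_] := xle n (m - n)%N; rewrite subnKC //.
      by have := r0 m; lra.
    have [+ _] := xle m (n - m)%N; rewrite subnKC //.
    by have := r0 n; lra.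
  (* Every left end is below every right end, so the supremum of the left ends lies in all the
     intervals. *)
  exists (sup (range x)) => n; apply/andP; split.
    apply: ub_le_sup; last by exists n.
    by exists (x 0%N + r 0%N) => _ [m _ <-].
  apply: sup_le_ub; first by exists (x 0%N); exists 0%N.
  by move=> _ [m _ <-]; exact: xub.
have [u Hu] : exists u, forall n, (sval (q n)).1.1 <= u <= (sval (q n)).1.1 + r n.
  apply: (nest (fun q => q.1.1) a) => // n.
  by rewrite /r /=; have [i [j ->]] := svalP (step (q n)); exists i.
have [v Hv] : exists v, forall n, (sval (q n)).1.2 <= v <= (sval (q n)).1.2 + r n.
  apply: (nest (fun q => q.1.2) b) => // n.
  by rewrite /r /=; have [i [j ->]] := svalP (step (q n)); exists j.
have [d d0 Hd] := loc u v (Hu 0%N) (Hv 0%N).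
have rE n : r n = s * 3^-1 ^+ n.
  elim: n => [|n IH]; first by rewrite expr0 mulr1.
  by rewrite rS IH exprSr mulrA.
have q3 : 0 <= (3^-1 : R) < 1 by apply/andP; split; lra.
have [N HN] := geometric_small s q3 d0.
have [_] := svalP (q N); apply; apply: (Hd _ _ _ _ (Hu N) (Hv N)).
by rewrite r0 /= -/(r N) rE HN.
Qed.

(** * Goursat's argument *)

Section Goursat.
Variables (R : realType) (E : completeNormedModType R[i]).
Implicit Types (f g : R[i] -> E) (x y s : R) (z : R[i]).

Definition cder f z (L : E) := forall e : R, 0 < e -> exists2 d : R, 0 < d &
  forall z', cabs (z' - z) < d ->
    nrm (f z' - f z - (z' - z) *: L) <= e * cabs (z' - z).

Definition hsum f N x y s : E :=
  (s / N%:R)%:C%C *: \sum_(k < N) f ((x + k%:R * (s / N%:R)) +i* y)%C.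
Definition vsum f N x y s : E :=
  (s / N%:R)%:C%C *: \sum_(k < N) f (x +i* (y + k%:R * (s / N%:R)))%C.

(* Riemann sum, with [N] sample points per side, of the integral of [f] around
   the square [x, x + s] x [y, y + s].  Sampling opposite sides at facing points
   makes the inner sides cancel in a subdivision, and kills affine [f] exactly. *)
Definition bsum f N x y s : E :=
  hsum f N x y s - hsum f N x (y + s) s +
  'i%C *: (vsum f N (x + s) y s - vsum f N x y s).

Definition square x y s z :=
  x <= complex.Re z <= x + s /\ y <= complex.Im z <= y + s.

Lemma tri_sum f N (F : nat -> R[i]) :
  \sum_(k < 3 * N) f (F k) = \sum_(i < 3) \sum_(k < N) f (F (i * N + k)%N).
Proof.
rewrite (_ : (3 * N = N + (N + N))%N); last by rewrite mulSn mul2n addnn.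
rewrite !big_split_ord /= !big_ord_recl big_ord0 addr0 /=.
congr (_ + (_ + _)); apply: eq_bigr => k _; congr (f (F _)); rewrite /bump /=.
  by rewrite mul1n.
by rewrite !add1n mulSn mul1n addnA.
Qed.

Lemma third_step (s : R) N : s / (3 * N)%:R = s / 3 / N%:R.
Proof. by rewrite natrM invfM mulrA. Qed.

Lemma third_point (s : R) N i k : (0 < N)%N ->
  (i * N + k)%:R * (s / 3 / N%:R) = i%:R * (s / 3) + k%:R * (s / 3 / N%:R).
Proof.
move=> N0; rewrite natrD natrM mulrDl; congr (_ + _).
by field; rewrite pnatr_eq0 -lt0n.
Qed.

Lemma hsum3 f N x y s : (0 < N)%N ->
  hsum f (3 * N) x y s = \sum_(i < 3) hsum f N (x + i%:R * (s / 3)) y (s / 3).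
Proof.
move=> N0; rewrite /hsum (tri_sum f N (fun k => (x + k%:R * (s / (3 * N)%:R)) +i* y)%C).
rewrite scaler_sumr third_step; apply: eq_bigr => i _; congr (_ *: _).
by apply: eq_bigr => k _; rewrite third_point // addrA.
Qed.

Lemma vsum3 f N x y s : (0 < N)%N ->
  vsum f (3 * N) x y s = \sum_(i < 3) vsum f N x (y + i%:R * (s / 3)) (s / 3).
Proof.
move=> N0; rewrite /vsum (tri_sum f N (fun k => x +i* (y + k%:R * (s / (3 * N)%:R)))%C).
rewrite scaler_sumr third_step; apply: eq_bigr => i _; congr (_ *: _).
by apply: eq_bigr => k _; rewrite third_point // addrA.
Qed.

Lemma telescope3 (h : R -> E) (y s : R) :
  \sum_(j < 3) (h (y + j%:R * (s / 3)) - h (y + j%:R * (s / 3) + s / 3)) =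
  h y - h (y + s).
Proof.
rewrite !big_ord_recl big_ord0 /bump /= addr0.
rewrite (_ : y + 0 * (s / 3) = y); last by ring.
rewrite (_ : y + 1 * (s / 3) = y + s / 3); last by ring.
rewrite (_ : y + 2 * (s / 3) = y + s / 3 + s / 3); last by ring.
rewrite (_ : y + s / 3 + s / 3 + s / 3 = y + s); last by field.
by rewrite [X in _ + X]subrKA subrKA.
Qed.

(** Inner sides telescope, and the samples of three adjacent cells are exactly the [3 * N] samples
    of an outer side, so the identity holds without any limit. *)
Lemma bsum3 f N x y s : (0 < N)%N ->
  bsum f (3 * N) x y s = \sum_(i < 3) \sum_(j < 3)
    bsum f N (x + i%:R * (s / 3)) (y + j%:R * (s / 3)) (s / 3).
Proof.
move=> N0; rewrite /bsum !hsum3 // !vsum3 //.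
under [RHS]eq_bigr => i _ do rewrite big_split /= -scaler_sumr.
rewrite [RHS]big_split /= -!sumrB -scaler_sumr; congr (_ + _ *: _).
  apply: eq_bigr => i _.
  by rewrite (telescope3 (fun y => hsum f N (x + i%:R * (s / 3)) y (s / 3))).
rewrite exchange_big /=; apply: eq_bigr => j _; rewrite -opprB.
rewrite -(telescope3 (fun x => vsum f N x (y + j%:R * (s / 3)) (s / 3))) -sumrN.
by apply: eq_bigr => i _; rewrite opprB.
Qed.

(** Bounds on [bsum] are asked for on the sides only, so that [f] may be singular inside. *)
Definition side_points x y s z := exists2 t, 0 <= t <= s &
  [\/ z = ((x + t) +i* y)%C, z = ((x + t) +i* (y + s))%C,
      z = ((x + s) +i* (y + t))%C | z = (x +i* (y + t))%C].

Lemma sample_in (s : R) N (k : 'I_N) : 0 <= s -> 0 <= k%:R * (s / N%:R) <= s.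
Proof.
move=> s0; have N0 : 0 < (N%:R : R) by rewrite ltr0n (leq_ltn_trans _ (ltn_ord k)).
apply/andP; split; first by rewrite mulr_ge0 // divr_ge0.
rewrite mulrA ler_pdivrMr // mulrC ler_wpM2l //.
by rewrite ler_nat ltnW.
Qed.

Lemma riemann_le N (s : R) (F : 'I_N -> E) B : (0 < N)%N -> 0 <= s ->
  (forall k, nrm (F k) <= B) -> nrm ((s / N%:R)%:C%C *: \sum_k F k) <= s * B.
Proof.
move=> N0 s0 FB; have NR : 0 < (N%:R : R) by rewrite ltr0n.
have sN : 0 <= s / N%:R by rewrite divr_ge0.
rewrite nrmZr // (_ : s * B = s / N%:R * (N%:R * B)).
  exact: ler_wpM2l (nrm_sum_ord FB).
by field; rewrite gt_eqF.
Qed.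

Lemma bsum_le f N x y s B : (0 < N)%N -> 0 <= s ->
  (forall z, side_points x y s z -> nrm (f z) <= B) ->
  nrm (bsum f N x y s) <= 4 * s * B.
Proof.
move=> N0 s0 fB.
have H1 y' : y' = y \/ y' = y + s -> nrm (hsum f N x y' s) <= s * B.
  move=> yE; apply: riemann_le => // k; apply: fB.
  exists (k%:R * (s / N%:R)); first exact: sample_in.
  by case: yE => ->; [constructor 1 | constructor 2].
have H2 x' : x' = x \/ x' = x + s -> nrm (vsum f N x' y s) <= s * B.
  move=> xE; apply: riemann_le => // k; apply: fB.
  exists (k%:R * (s / N%:R)); first exact: sample_in.
  by case: xE => ->; [constructor 4 | constructor 3].
rewrite /bsum; apply: (le_trans (nrmD _ _)); rewrite nrmZ cabs_i mul1r.
apply: (le_trans (lerD (nrmB _ _) (nrmB _ _))).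
have := H1 y (or_introl erefl); have := H1 _ (or_intror erefl).
have := H2 x (or_introl erefl); have := H2 _ (or_intror erefl).
by move=> ? ? ? ?; lra.
Qed.

Lemma hsumD f g N x y s :
  hsum (fun z => f z + g z) N x y s = hsum f N x y s + hsum g N x y s.
Proof. by rewrite /hsum big_split scalerDr. Qed.

Lemma vsumD f g N x y s :
  vsum (fun z => f z + g z) N x y s = vsum f N x y s + vsum g N x y s.
Proof. by rewrite /vsum big_split scalerDr. Qed.

Lemma bsumD f g N x y s :
  bsum (fun z => f z + g z) N x y s = bsum f N x y s + bsum g N x y s.
Proof.
have D (a b c d : E) : a + b - (c + d) = a - c + (b - d) by rewrite opprD addrACA.
by rewrite /bsum !hsumD !vsumD !D scalerDr addrACA.
Qed.

(** Facing samples differ by [- i s b] on the horizontal sides and by [s b] on the vertical ones;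
    the factor [i] makes them cancel term by term. *)
Lemma bsum_affine N x y s (a b : E) : bsum (fun z => a + z *: b) N x y s = 0.
Proof.
rewrite /bsum /hsum /vsum -!scalerBr -!sumrB scalerA [_ * _%:C%C]mulrC -scalerA.
rewrite -scalerDr scaler_sumr -big_split /= big1 ?scaler0 // => k _.
rewrite !opprD !addrA ![a + _ - a]addrAC subrr !add0r -!scalerBl scalerA -scalerDl.
rewrite (_ : _ + _ = 0) ?scale0r //.
by apply/eqP; rewrite eq_complex /=; apply/andP; split; apply/eqP; ring.
Qed.

Lemma side_in_square x y s z : side_points x y s z -> square x y s z.
Proof.
move=> [t /andP[t0 ts] [] ->]; split=> /=; apply/andP; split; lra.
Qed.

Lemma square_dist x y s z z' : square x y s z -> square x y s z' ->
  cabs (z - z') <= 2 * s.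
Proof.
case: z z' => [a b] [a' b'] [/= /andP[? ?] /andP[? ?]] [/= /andP[? ?] /andP[? ?]].
apply: (le_trans (cabs_le_ReIm _)) => /=.
have : `|a - a'| <= s by rewrite ler_norml; apply/andP; split; lra.
have : `|b - b'| <= s by rewrite ler_norml; apply/andP; split; lra.
by move=> ? ?; lra.
Qed.

(** The affine part of [f] at [w] contributes nothing. The remainder is at most [(e / 8) (2 s)] on
    the sides, since points of the square are within [2 s] of [w], and the perimeter is [4 s]. *)
Lemma bsum_cder f w L (e : R) : 0 < e -> cder f w L ->
  exists2 d : R, 0 < d & forall x y s N, 0 < s < d -> (0 < N)%N ->
    square x y s w -> nrm (bsum f N x y s) <= e * s ^+ 2.
Proof.
move=> e0 fL; have [|d d0 Hd] := fL (e / 8); first by rewrite divr_gt0.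
exists (d / 2) => [|x y s N /andP[s0 sd] N0 wQ]; first by rewrite divr_gt0.
pose r z := f z - f w - (z - w) *: L.
have -> : f = (fun z => (f w - w *: L + z *: L) + r z).
  have D (a b c d' : E) : d' = a - b + c + (d' - a - (c - b)).
    by rewrite -[d' - a - _]addrA -opprD [a + (c - b)]addrA [a + c - b]addrAC [RHS]addrC subrK.
  by apply/funext => z; rewrite /r scalerBl -D.
rewrite bsumD bsum_affine add0r.
apply: (le_trans (@bsum_le _ _ _ _ _ (e / 8 * (2 * s)) N0 (ltW s0) _)); last by lra.
move=> z /side_in_square zQ; have zw := square_dist zQ wQ.
apply: (le_trans (Hd _ _)); first by lra.
by rewrite ler_wpM2l // divr_ge0 // ltW.
Qed.

(** A bound proportional to the area survives gluing, because nine cells with [c (s / 3)^2] each add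
    up to [c s^2]. *)
Lemma goursat f x y s (e : R) : 0 < s -> 0 < e ->
  (forall z, square x y s z -> exists L, cder f z L) ->
  exists n0, forall n, (n0 <= n)%N -> nrm (bsum f (3 ^ n) x y s) <= e.
Proof.
move=> s0 e0 fd; pose c := e / s ^+ 2.
have c0 : 0 < c by rewrite divr_gt0 // exprn_gt0.
pose P x y s := exists n0, forall n, (n0 <= n)%N ->
  nrm (bsum f (3 ^ n) x y s) <= c * s ^+ 2.
suff [n0 Hn0] : P x y s.
  by exists n0 => n /Hn0; rewrite /c divfK // gt_eqF // exprn_gt0.
apply: square_induction => // [x1 y1 s1 s10 IH|u v uI vI].
  have {}IH (i j : 'I_3) := cid (IH i j).
  pose m := (\max_(i < 3) \max_(j < 3) sval (IH i j))%N.
  (* One factor 3 of the sample count is spent on the subdivision, hence the successor and the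
     powers of 3. *)
  exists m.+1 => -[//|n]; rewrite ltnS => mn.
  rewrite expnS bsum3 ?expn_gt0 //.
  rewrite (_ : c * _ = 3%:R * (3%:R * (c * (s1 / 3) ^+ 2))); last by field.
  apply: nrm_sum_ord => i; apply: nrm_sum_ord => j.
  apply: (svalP (IH i j)); apply: leq_trans mn.
  apply: leq_trans (leq_bigmax i).
  exact: (@leq_bigmax _ (fun j => sval (IH i j)) j).
have [|L fL] := fd (u +i* v)%C; first by split.
have [d d0 Hd] := bsum_cder c0 fL.
exists d => // x' y' s' s'd uI' vI'; exists 0%N => n _.
by apply: Hd => //; rewrite ?expn_gt0.
Qed.

(* Subdividing by three keeps the singular point [0] interior to the central
   subsquare, away from the sides on which [f] is sampled. *)
Lemma center_cell f (k : nat) (B : R) (e : R) : 0 < e ->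
  (forall z, z != 0 -> square (-1) (-1) 2 z -> exists L, cder f z L) ->
  let t := 3^-1 ^+ k in
  (exists n0, forall n, (n0 <= n)%N ->
    nrm (bsum f (3 ^ n) (- t) (- t) (2 * t)) <= B) ->
  exists n0, forall n, (n0 <= n)%N -> nrm (bsum f (3 ^ n) (-1) (-1) 2) <= B + e.
Proof.
move=> + fd; elim: k B e => [|k IH] B e e0 /= [n0 Hn0].
  rewrite expr0 mulr1 in Hn0; exists n0 => n /Hn0 /le_trans; apply; lra.
(* Half of [e] pays for this level, the other half for all larger squares. *)
suff [n1 Hn1] : exists n0, forall n, (n0 <= n)%N ->
    nrm (bsum f (3 ^ n) (- 3^-1 ^+ k) (- 3^-1 ^+ k) (2 * 3^-1 ^+ k)) <= B + e / 2.
  have [||n2 Hn2] := IH (B + e / 2) (e / 2); first by rewrite divr_gt0.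
    by exists n1.
  by exists n2 => n /Hn2 /le_trans; apply; lra.
rewrite exprSr in Hn0; set t := 3^-1 ^+ k in Hn0 *.
have t0 : 0 < t by rewrite exprn_gt0.
have t1 : t <= 1 by rewrite exprn_ile1 //; lra.
pose o : 'I_3 := @Ordinal 3 1 isT.
(* The outer cells avoid [0], so [goursat] makes each of them small; at most nine times [e / 32]
   stays below [e / 2]. *)
have H (ij : 'I_3 * 'I_3) : exists n1, forall n, (n1 <= n)%N ->
    nrm (bsum f (3 ^ n) (- t + ij.1%:R * (2 * t / 3)) (- t + ij.2%:R * (2 * t / 3))
      (2 * t / 3)) <= (if ij == (o, o) then B else e / 32).
  case: eqP => [->|ij1] /=.
    by exists n0 => n /Hn0; rewrite /o /= [2 * (t / 3)]mulrA (_ : - t + _ = - (t / 3)) //; field.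
  apply: goursat => [||z zQ].
  - by rewrite !divr_gt0 // mulr_gt0.
  - by rewrite divr_gt0.
  apply: fd.
    apply/eqP => z0; rewrite z0 in zQ; case: zQ => /= /andP[Q1 Q2] /andP[Q3 Q4].
    case: ij ij1 Q1 Q2 Q3 Q4 => [[[|[|[|]]] //= i3] [[|[|[|]]] //= j3]] ij1 *;
      try lra.
    by apply: ij1; congr (_, _); apply: val_inj.
  have i2 (i : 'I_3) : 0 <= i%:R * (2 * t / 3) <= 2 * (2 * t / 3).
    have i2 : (i%:R : R) <= 2 by rewrite ler_nat -ltnS.
    have i0 : 0 <= (i%:R : R) by [].
    by apply/andP; split; nra.
  have /andP[a0 a2] := i2 ij.1; have /andP[b0 b2] := i2 ij.2.
  by case: zQ => /andP[Q1 Q2] /andP[Q3 Q4]; split; apply/andP; split; lra.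
pose m := (\max_ij sval (cid (H ij)))%N.
exists m.+1 => -[//|n]; rewrite ltnS => mn.
rewrite expnS bsum3 ?expn_gt0 // pair_bigA /= (bigD1 (o, o)) //=.
have HH ij := svalP (cid (H ij)) n (leq_trans (leq_bigmax ij) mn).
apply: (le_trans (nrmD _ _)); apply: lerD; first exact: (HH (o, o)).
apply: (le_trans (nrm_sum _ _ _)).
apply: (@le_trans _ _ (\sum_(ij : 'I_3 * 'I_3 | ij != (o, o)) e / 32)).
  by apply: ler_sum => ij /negPf ne; have := HH ij; rewrite ne.
rewrite sumr_const.
set p := #|_|; have p9 : (p%:R : R) <= 9.
  by rewrite ler_nat (leq_trans (max_card _)) // card_prod !card_ord.
rewrite -[_ *+ p]mulr_natr; apply: (@le_trans _ _ (e / 32 * 9)); last by lra.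
have e32 : 0 <= e / 32 by rewrite divr_ge0 // ltW.
exact: ler_wpM2l e32 _ _ p9.
Qed.

End Goursat.

(** * Cauchy's estimate *)

Section Cauchy.
Variables (R : realType) (E : completeNormedModType R[i]).
Implicit Types (f g : R[i] -> E) (x y s : R) (z : R[i]).

(** The sides of the central square of half-width [t] have distance at least [t] from [0], so there
    [f] is at most [(e / 16) / t], while the perimeter is [8 t]: the product no longer depends on
    [t]. *)
Lemma punctured_goursat f :
  (forall z, z != 0 -> square (-1) (-1) 2 z -> exists L, cder f z L) ->
  (forall e : R, 0 < e -> exists2 d : R, 0 < d & forall z, 0 < cabs z < d ->
    nrm (f z) * cabs z <= e) ->
  forall e : R, 0 < e ->
    exists n0, forall n, (n0 <= n)%N -> nrm (bsum f (3 ^ n) (-1) (-1) 2) <= e.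
Proof.
move=> fd f0 e e0; have [|d d0 Hd] := f0 (e / 16); first by rewrite divr_gt0.
have q3 : 0 <= (3^-1 : R) < 1 by apply/andP; split; lra.
have [k Hk] := geometric_small 2 q3 d0.
have {Hk} := Hk k (leqnn k); set t := 3^-1 ^+ k => td.
have t0 : 0 < t by rewrite exprn_gt0.
rewrite [e]splitr; apply: (center_cell (k := k)) => //.
  by rewrite divr_gt0.
exists 0%N => n _; rewrite -/t.
have -> : e / 2 = 4 * (2 * t) * (e / 16 / t) by field; rewrite gt_eqF.
apply: bsum_le; rewrite ?expn_gt0 ?mulr_ge0 ?(ltW t0) // => z zs.
have zt : t <= cabs z.
  case: zs => [r _ []] ->.
  - by apply: le_trans (Im_le_cabs _); rewrite /= normrN ger0_norm // ltW.
  - apply: le_trans (Im_le_cabs _); rewrite /= ger0_norm; lra.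
  - apply: le_trans (Re_le_cabs _); rewrite /= ger0_norm; lra.
  - by apply: le_trans (Re_le_cabs _); rewrite /= normrN ger0_norm // ltW.
have z2t : cabs z <= 2 * t.
  case: zs => [r /andP[r0 rt] zE]; apply: (le_trans (cabs_le_ReIm _)).
  suff [] : `|complex.Re z| <= t /\ `|complex.Im z| <= t by lra.
  by case: zE => -> /=; split; rewrite ler_norml; apply/andP; split; lra.
rewrite ler_pdivlMr //; have := Hd z; rewrite (lt_le_trans t0 zt).
rewrite (le_lt_trans z2t td) => /(_ isT); apply: le_trans.
by rewrite ler_wpM2l // nrm_ge0.
Qed.

Lemma subr_cancelr (x y c : E) : x - c - (y - c) = x - y.
Proof. by rewrite opprB subrKA. Qed.

Lemma subr_exchange (x y t u : E) : x - t - (y - u) = x - y - (t - u).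
Proof. by rewrite opprD addrACA -opprD. Qed.

Lemma cder_affine g z L L' (b : E) :
  cder g z L -> cder (fun z => g z - b - z *: L') z (L - L').
Proof.
move=> gL e /gL[d d0 Hd]; exists d => // z' /Hd.
set lhs := nrm _ => Hz; rewrite (_ : nrm _ = lhs) //; congr nrm.
by rewrite subr_exchange subr_cancelr scalerBr -scalerBl subr_cancelr.
Qed.

Lemma cder_scaleV g z L : z != 0 -> cder g z L ->
  cder (fun z => z^-1 *: g z) z (z^-1 *: L - z^-2 *: g z).
Proof.
move=> z0 gL e e0; have a0 : 0 < cabs z by rewrite cabs_gt0.
set a := cabs z in a0.
(* [K] collects the coefficients of the three error terms below. In the radius, [a / 2] keeps [z']
   away from [0], and [e / K] turns [|h|^2] into [(e / K) |h|]. *)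
pose K := 2 / a + 2 / a ^+ 3 * nrm (g z) + 2 / a ^+ 2 * nrm L + 1.
have K0 : 0 < K.
  by rewrite ltr_wpDl // !addr_ge0 ?mulr_ge0 ?nrm_ge0 ?invr_ge0 ?exprn_ge0 // ltW.
have eK : 0 < e / K by rewrite divr_gt0.
have [d d0 Hd] := gL _ eK.
exists (Num.min d (Num.min (a / 2) (e / K))).
  by rewrite !lt_min d0 eK divr_gt0.
move=> z'; rewrite !lt_min => /and3P[hd ha he].
set h := z' - z in hd ha he.
have z'a : a / 2 <= cabs z'.
  have := cabsD z' (- h); rewrite cabsN (_ : z' - h = z); last by rewrite /h; ring.
  by rewrite -/a; lra.
have z'0 : z' != 0 by rewrite -cabs_gt0; lra.
have -> : z'^-1 *: g z' - z^-1 *: g z - h *: (z^-1 *: L - z^-2 *: g z) =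
    z'^-1 *: (g z' - g z - h *: L) + (h ^+ 2 / (z ^+ 2 * z')) *: g z
    - (h ^+ 2 / (z * z')) *: L.
  rewrite !scalerBr !scalerA.
  have -> : h ^+ 2 / (z ^+ 2 * z') = z'^-1 - z^-1 + h * z^-2.
    by rewrite /h; field; rewrite z0 z'0.
  have -> : h ^+ 2 / (z * z') = h / z - z'^-1 * h.
    by rewrite /h; field; rewrite z0 z'0.
  rewrite [(_ + h * _) *: _]scalerDl !scalerBl.
  move: (z'^-1 *: g z') (z'^-1 *: g z) (z^-1 *: g z) ((h / z ^+ 2) *: g z) (_ *: L) (_ *: L).
  move=> p q r s t v.
  by rewrite [p - q - t + _]addrACA subrKA [- t + s]addrC -[RHS]addrA subr_cancelr opprB.
have hh : cabs h ^+ 2 <= e / K * cabs h.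
  by rewrite expr2 ler_wpM2r ?cabs_ge0 // ltW.
have iz' : cabs z'^-1 <= 2 / a.
  by rewrite cabsV -[2 / a]invf_div lef_pV2 // posrE ?divr_gt0 //; lra.
have i0 : 0 < a^-1 by rewrite invr_gt0.
apply: (@le_trans _ _ (2 / a * (e / K * cabs h) + e / K * cabs h * (2 / a ^+ 3) * nrm (g z)
   + e / K * cabs h * (2 / a ^+ 2) * nrm L)).
  apply: (le_trans (nrmB _ _)); apply: lerD; first apply: (le_trans (nrmD _ _)); first apply: lerD.
  - rewrite nrmZ; apply: ler_pM; rewrite ?cabs_ge0 ?nrm_ge0 //.
    exact: Hd.
  - rewrite nrmZ ler_wpM2r ?nrm_ge0 // cabsM cabsX cabsV cabsM ?cabsX invfM -/a.
    rewrite cabsV in iz'; apply: ler_pM => //; rewrite ?mulr_ge0 ?invr_ge0 ?exprn_ge0 ?cabs_ge0 //.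
    rewrite (_ : 2 / a ^+ 3 = (a ^+ 2)^-1 * (2 / a)).
      by rewrite ler_wpM2l // invr_ge0 exprn_ge0 // ltW.
    by field; rewrite gt_eqF.
  - rewrite nrmZ ler_wpM2r ?nrm_ge0 // cabsM cabsX cabsV cabsM ?cabsX invfM -/a.
    rewrite cabsV in iz'; apply: ler_pM => //; rewrite ?mulr_ge0 ?invr_ge0 ?exprn_ge0 ?cabs_ge0 //.
    rewrite (_ : 2 / a ^+ 2 = a^-1 * (2 / a)).
      by rewrite ler_wpM2l // ltW.
    by field; rewrite gt_eqF.
have -> : e * cabs h = e / K * cabs h * K by field; rewrite gt_eqF.
have : 0 <= e / K * cabs h by rewrite mulr_ge0 ?cabs_ge0 // ltW.
by rewrite /K; move: (e / K * cabs h) => x x0; lra.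
Qed.

(** This stands in for the value [2 pi i] of the integral of [1 / z]. The four facing samples with
    parameter [u] in [[-1, 1]] add up to [4 i / (u^2 + 1)], all of the same argument and of modulus
    at least 2. *)
Lemma bsum_inv N (L : E) : (0 < N)%N ->
  4 * nrm L <= nrm (bsum (fun z => z^-1 *: L) N (-1) (-1) 2).
Proof.
move=> N0; have NR : 0 < (N%:R : R) by rewrite ltr0n.
pose u (k : 'I_N) : R := -1 + k%:R * (2 / N%:R).
have -> : bsum (fun z => z^-1 *: L) N (-1) (-1) 2 =
    ((2 / N%:R)%:C%C * \sum_k ('i%C * (4 / (u k ^+ 2 + 1))%:C%C)) *: L.
  rewrite /bsum /hsum /vsum -!scalerBr -!sumrB (scalerA 'i%C) [X in _ + X *: _]mulrC.
  rewrite -[X in _ + X]scalerA -scalerDr scaler_sumr -big_split /= -scalerA.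
  congr (_ *: _); rewrite scaler_suml; apply: eq_bigr => k _.
  rewrite -!scalerBl scalerA -scalerDl; congr (_ *: _); rewrite -/(u k).
  have u1 : u k ^+ 2 + 1 != 0 by rewrite gt_eqF // ltr_wpDl // sqr_ge0.
  by apply/eqP; rewrite eq_complex /=; apply/andP; split; apply/eqP; field; exact: u1.
rewrite -mulr_sumr -rmorph_sum nrmZ ler_wpM2r ?nrm_ge0 // !cabsM cabs_i mul1r.
rewrite !cabs_real [X in _ <= X * _]ger0_norm ?divr_ge0 //.
rewrite [leLHS](_ : 4 = 2 / N%:R * (N%:R * 2)); last by field; rewrite gt_eqF.
rewrite ler_wpM2l ?divr_ge0 //; apply: le_trans (ler_norm _).
rewrite -[N in N%:R * 2]card_ord.
rewrite mulrC mulr_natr -sumr_const; apply: ler_sum => k _.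
have u0 : -1 <= u k <= 1.
  have s2 : 0 <= (2 : R) by [].
  have /andP[k0 k2] := sample_in k s2; apply/andP; rewrite /u; split; lra.
rewrite ler_pdivlMr ?ltr_wpDl ?sqr_ge0 //.
move: (u k) u0 => v /andP[v0 v1].
have : 0 <= (1 - v) * (1 + v) by rewrite mulr_ge0; lra.
nra.
Qed.

(** The function [(g z - g 0 - z L) / z^2] is [o(1 / |z|)] at [0], so its sums vanish in the limit.
    Hence the sums of [L / z], of norm at least [4 |L|], agree in the limit with those of
    [(g z - g 0) / z^2], which are at most [8 (2 M)] because [|z| >= 1] on the sides. *)
Theorem cauchy_estimate g (L : E) (M : R) :
  (forall z, square (-1) (-1) 2 z -> exists L', cder g z L') ->
  (forall z, square (-1) (-1) 2 z -> nrm (g z) <= M) ->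
  cder g 0 L -> nrm L <= 4 * M.
Proof.
move=> gd gM gL; pose r z := g z - g 0 - z *: L.
have sq0 : square (-1 : R) (-1) 2 0 by split; apply/andP; split => /=; lra.
suff H e : 0 < e -> nrm L <= 4 * M + e by apply: nrm_ge_contra => e /H.
move=> e0; pose f z := z^-1 *: (z^-1 *: r z).
have fd z : z != 0 -> square (-1) (-1) 2 z -> exists L', cder f z L'.
  move=> z0 /gd[L' gL']; eexists; apply: cder_scaleV => //.
  by apply: cder_scaleV => //; apply: cder_affine gL'.
have f0 e1 : 0 < e1 -> exists2 d : R, 0 < d & forall z, 0 < cabs z < d ->
    nrm (f z) * cabs z <= e1.
  move=> /gL[d d0 Hd]; exists d => // z /andP[z0 zd].
  rewrite !nrmZ cabsV (_ : _ * _ = nrm (r z) / cabs z); last by field; rewrite gt_eqF.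
  rewrite ler_pdivrMr //.
  by have := Hd z; rewrite subr0; apply.
have [|n0 Hn0] := punctured_goursat fd f0 (_ : 0 < 4 * e); first by rewrite mulr_gt0.
have {Hn0} := Hn0 _ (leqnn n0).
have -> : f =
   (fun z => z^-1 *: (z^-1 *: (g z - g 0)) + z^-1 *: (- L)).
  apply/funext => z; rewrite /f /r scalerBr scalerA [z^-1 *: _]scalerBr scalerN.
  congr (_ - _); rewrite !scalerA; congr (_ *: _).
  (* At [0] both sides vanish, as the inverse of [0] is [0]. *)
  by have [->|z0] := eqVneq z 0; [rewrite invr0 !mul0r | rewrite -mulrA mulVf ?mulr1].
rewrite bsumD; set A := bsum _ _ _ _ _; set B := bsum _ _ _ _ _ => AB.
have N0 : (0 < 3 ^ n0)%N by rewrite expn_gt0.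
have A16 : nrm A <= 4 * 2 * (2 * M).
  apply: bsum_le => // z zs; have zM := gM _ (side_in_square zs).
  have z1 : 1 <= cabs z.
    case: zs => [t _ []] ->.
    - by apply: le_trans (Im_le_cabs _); rewrite /= normrN1.
    - by apply: le_trans (Im_le_cabs _); rewrite /= ger0_norm; lra.
    - by apply: le_trans (Re_le_cabs _); rewrite /= ger0_norm; lra.
    - by apply: le_trans (Re_le_cabs _); rewrite /= normrN1.
  have V : cabs z^-1 <= 1 by rewrite cabsV invf_le1 // (lt_le_trans _ z1).
  have X : nrm (g z - g 0) <= 2 * M by have := nrmB (g z) (g 0); have := gM _ sq0; lra.
  rewrite !nrmZ -[2 * M]mul1r; apply: ler_pM; rewrite ?mulr_ge0 ?cabs_ge0 ?nrm_ge0 //.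
  by rewrite -[2 * M]mul1r; apply: ler_pM; rewrite ?cabs_ge0 ?nrm_ge0.
have := bsum_inv (- L) N0; rewrite -/B nrmN.
have := nrmB (A + B) A; rewrite addrC addKr => *; lra.
Qed.

End Cauchy.

(** * Frechet derivatives *)

Section Frechet.
Variables (R : realType) (E : completeNormedModType R[i]).
Implicit Types (f g : E -> E) (L : E -> E).

Definition fder f x L :=
  [/\ forall (k : R[i]) u v, L (k *: u + v) = k *: L u + L v,
      exists2 K : R, 0 <= K & forall v, nrm (L v) <= K * nrm v &
      forall e : R, 0 < e -> exists2 d : R, 0 < d & forall h, nrm h < d ->
        nrm (f (x + h) - f x - L h) <= e * nrm h].

Lemma fder_id x : fder id x id.
Proof.
split=> //; first by exists 1 => // v; rewrite mul1r.
move=> e e0; exists 1 => // h _.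
by rewrite /= [x + h]addrC addrK subrr nrm0 mulr_ge0 ?nrm_ge0 // ltW.
Qed.

Section Linear.
Variable L : E -> E.
Hypothesis linL : forall (k : R[i]) u v, L (k *: u + v) = k *: L u + L v.

Lemma lin0 : L 0 = 0.
Proof.
have := linL 1 0 0; rewrite !scale1r addr0 => /eqP.
by rewrite -subr_eq subrr => /eqP <-.
Qed.

Lemma linZ k u : L (k *: u) = k *: L u.
Proof. by have := linL k u 0; rewrite !addr0 lin0 addr0. Qed.

Lemma linB u v : L (u - v) = L u - L v.
Proof. by rewrite addrC -scaleN1r linL scaleN1r addrC. Qed.

End Linear.

Lemma fder_comp f g x L M : fder f x L -> fder g (f x) M ->
  fder (fun y => g (f y)) x (fun v => M (L v)).
Proof.
move=> [linL [K K0 HK] fL] [linM [K' K'0 HK'] gM]; split.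
- by move=> k u v; rewrite linL linM.
- exists (K' * K) => [|v]; first exact: mulr_ge0.
  by apply: (le_trans (HK' _)); rewrite -mulrA ler_wpM2l.
(* [e1] controls the remainder of [g] and [e2] that of [f] after [M]. The minimum with 1 gives
   [|f (x + h) - f x| <= (K + 1) |h|]. *)
move=> e e0; pose e1 := e / (2 * (K + 1)); pose e2 := Num.min 1 (e / (2 * (K' + 1))).
have K1 : 0 < K + 1 by rewrite ltr_wpDl.
have K'1 : 0 < K' + 1 by rewrite ltr_wpDl.
have e10 : 0 < e1 by rewrite divr_gt0 // mulr_gt0.
have e20 : 0 < e2 by rewrite lt_min ltr01 divr_gt0 // mulr_gt0.
have [d1 d10 H1] := gM e1 e10; have [d2 d20 H2] := fL e2 e20.
exists (Num.min d2 (d1 / (K + 1))) => [|h]; first by rewrite lt_min d20 divr_gt0.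
rewrite lt_min => /andP[hd2 hd1]; have {}H2 := H2 h hd2.
set k := f (x + h) - f x in H2.
have kh : nrm k <= (K + 1) * nrm h.
  rewrite -(subrK (L h) k); apply: (le_trans (nrmD _ _)).
  have e21 : e2 * nrm h <= 1 * nrm h by rewrite ler_wpM2r ?nrm_ge0 // ge_min lexx.
  by have := HK h; move: H2; lra.
have kd : nrm k < d1.
  by apply: (le_lt_trans kh); rewrite mulrC -ltr_pdivlMr.
have {}H1 := H1 k kd; rewrite [f x + k]addrC subrK in H1.
rewrite -(subrK (M k) (g _ - _)) -addrA -(linB linM).
apply: (le_trans (nrmD _ _)); have {}HK' := HK' (k - L h).
have h0 := nrm_ge0 h.
have A : e1 * nrm k <= e / 2 * nrm h.
  rewrite (_ : e / 2 * nrm h = e1 * ((K + 1) * nrm h)); last first.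
    by rewrite /e1; field; rewrite gt_eqF.
  by rewrite ler_wpM2l // ltW.
have B : K' * nrm (k - L h) <= e / 2 * nrm h.
  apply: (@le_trans _ _ ((K' + 1) * (e2 * nrm h))).
    by apply: ler_pM; rewrite ?nrm_ge0 // lerDl.
  rewrite mulrA ler_wpM2r // mulrC -ler_pdivlMr // -mulrA -invfM.
  by rewrite ge_min lexx orbT.
by rewrite [e]splitr mulrDl; apply: lerD; [exact: le_trans H1 A | exact: le_trans HK' B].
Qed.

(** When [c = f x], the value at [x] stays and the derivative gains the factor [1 + k]; this is the
    source of the geometric decay in [earle_hamilton]. *)
Lemma fder_stretch f x L (k : R[i]) c : fder f x L ->
  fder (fun y => f y + k *: (f y - c)) x (fun v => (1 + k) *: L v).
Proof.
move=> [linL [K K0 HK] fL]; split.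
- by move=> a u v; rewrite linL scalerDr !scalerA mulrC.
- exists (cabs (1 + k) * K) => [|v]; first by rewrite mulr_ge0 ?cabs_ge0.
  by rewrite nrmZ -mulrA ler_wpM2l ?cabs_ge0.
move=> e e0; pose C := cabs (1 + k) + 1.
have C0 : 0 < C by rewrite ltr_wpDl ?cabs_ge0.
have [d d0 Hd] := fL _ (divr_gt0 e0 C0); exists d => // h /Hd.
have -> : f (x + h) + k *: (f (x + h) - c) - (f x + k *: (f x - c)) - (1 + k) *: L h
   = (1 + k) *: (f (x + h) - f x - L h).
  rewrite opprD addrACA -scalerBr subr_cancelr [RHS]scalerBr; congr (_ - _).
  by rewrite scalerDl scale1r.
move=> H; rewrite nrmZ.
have := ler_pM (cabs_ge0 (1 + k)) (nrm_ge0 _) (ltW (_ : cabs (1 + k) < C)) H.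
rewrite ltrDl => /(_ ltr01) /le_trans; apply.
by rewrite mulrA [C * _]mulrC divfK ?gt_eqF.
Qed.

Lemma fder_addl f x L c : fder f x L -> fder (fun y => c + f y) x L.
Proof.
move=> [linL bL fL]; split=> // e /fL[d d0 Hd]; exists d => // h /Hd.
by rewrite opprD addrACA subrr add0r.
Qed.

Lemma differentiable_fder f x : differentiable f x -> exists L, fder f x L.
Proof.
move=> /diff_locallyP [cd fd]; exists ('d f x); split.
- by move=> k u v; rewrite linearP.
- have /linear_bounded_continuous/linear_boundedP := cd.
  move=> [M [Mr HM]].
  have M0 : M < (`|complex.Re M| + 1)%:C%C.
    rewrite -(RRe_real Mr) ltcR.
    by have := ler_norm (complex.Re M); lra.
  exists (`|complex.Re M| + 1); first by rewrite addr_ge0.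
  by move=> v; have := HM _ M0 v; rewrite !nrmE -rmorphM lecR.
move=> e e0; move/eqaddoP: fd => /(_ e%:C%C); rewrite ltcR => /(_ e0).
move=> /nbhs_normP[d /= /pos_realC[d' d'0 ->] Hd]; exists d' => // h hd.
have := Hd h; rewrite /ball_ /= sub0r normrN nrmE ltcR => /(_ hd).
rewrite /= !fctE /= !nrmE -rmorphM lecR [h + x]addrC opprD addrA.
by [].
Qed.

Lemma fder_line f (a v : E) z L : fder f (a + z *: v) L ->
  cder (fun z => f (a + z *: v)) z (L v).
Proof.
move=> [linL _ fL] e e0; have v1 : 0 < nrm v + 1 by rewrite ltr_wpDl ?nrm_ge0.
have [d d0 Hd] := fL _ (divr_gt0 e0 v1).
exists (d / (nrm v + 1)) => [|z' zz']; first by rewrite divr_gt0.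
have E1 : a + z' *: v = a + z *: v + (z' - z) *: v.
  by rewrite scalerBl -addrA subrKC.
rewrite E1 -(linZ linL); apply: (le_trans (Hd _ _)); rewrite nrmZ.
  apply: (@le_lt_trans _ _ (cabs (z' - z) * (nrm v + 1))).
    by rewrite ler_wpM2l ?cabs_ge0 // lerDl.
  by rewrite -ltr_pdivlMr.
rewrite mulrCA mulrC ler_wpM2r ?cabs_ge0 // mulrAC ler_pdivrMr //.
by rewrite ler_wpM2l ?(ltW e0) // lerDl.
Qed.

(** Apply [cauchy_estimate] on the complex line through [a] in direction [v]. Scaling [v] to norm
    [d / 2] keeps the square, whose points have modulus at most 2, inside the ball; this turns 4
    into 8. *)
Lemma cauchy_fder f a L (M d : R) : 0 < d ->
  (forall y, nrm (y - a) <= d -> exists L', fder f y L') ->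
  (forall y, nrm (y - a) <= d -> nrm (f y) <= M) ->
  fder f a L -> forall v, nrm (L v) <= 8 * M / d * nrm v.
Proof.
move=> d0 fd fM fL v; have [linL _ _] := fL.
have [->|v0] := eqVneq v 0; first by rewrite (lin0 linL) nrm0 mulr0.
rewrite -nrm_gt0 in v0; pose k : R := d / (2 * nrm v).
have k0 : 0 < k by rewrite divr_gt0 // mulr_gt0.
pose u := k%:C%C *: v.
have du : nrm u = d / 2 by rewrite nrmZr ?(ltW k0) // /k; field; rewrite gt_eqF.
have near z : square (-1) (-1) 2 z -> nrm (a + z *: u - a) <= d.
  move=> [/andP[z1 z2] /andP[z3 z4]]; rewrite [a + _]addrC addrK nrmZ du.
  have : cabs z <= 2.
    apply: (le_trans (cabs_le_ReIm _)).
    have : `|complex.Re z| <= 1 by rewrite ler_norml; apply/andP; split; lra.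
    by have : `|complex.Im z| <= 1 by [rewrite ler_norml; apply/andP; split; lra]; lra.
  by move=> c2; nra.
have a0 : a + 0 *: u = a by rewrite scale0r addr0.
have : nrm (L u) <= 4 * M.
  apply: (@cauchy_estimate _ _ (fun z => f (a + z *: u))).
  - by move=> z /near/fd[L' fL']; exists (L' u); apply: fder_line.
  - by move=> z /near/fM.
  - by apply: fder_line; rewrite a0.
rewrite (linZ linL) nrmZr ?(ltW k0) // => H.
have -> : 8 * M / d * nrm v = k^-1 * (4 * M) by rewrite /k; field; rewrite !gt_eqF.
by rewrite ler_pdivlMl.
Qed.

(** [square_induction] is used with a dummy second coordinate. Locally, the estimates from [u] to
    the two ends add up because [u] lies between them; the slack [e] absorbs the remainder of the
    derivative. *)
Lemma mean_value_fder f (a b : E) (K : R) : 0 <= K ->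
  (forall s : R, 0 <= s <= 1 -> exists2 L, fder f (a + s%:C%C *: (b - a)) L &
     forall v, nrm (L v) <= K * nrm v) ->
  nrm (f b - f a) <= K * nrm (b - a).
Proof.
move=> K0 fK; pose c (s : R) := a + s%:C%C *: (b - a).
have c0 : c 0 = a by rewrite /c scale0r addr0.
have c1 : c 1 = b by rewrite /c scale1r subrKC.
have B0 := nrm_ge0 (b - a).
apply: nrm_ge_contra => e e0.
pose K1 := K * nrm (b - a) + e.
suff : nrm (f (c (0 + 1)) - f (c 0)) <= K1 * 1 by rewrite add0r c0 c1 mulr1.
apply: (@square_induction R (fun x _ s => nrm (f (c (x + s)) - f (c x)) <= K1 * s) 0 0 1) => //.
  move=> x y s s0 H.
  have Hj (j : 'I_3) := H j ord0.
  have := Hj (@Ordinal 3 0 isT); have := Hj (@Ordinal 3 1 isT).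
  have := Hj (@Ordinal 3 2 isT) => /=; rewrite mul0r addr0 mul1r.
  rewrite (_ : x + 2 * (s / 3) = x + s / 3 + s / 3); last by ring.
  rewrite (_ : x + s / 3 + s / 3 + s / 3 = x + s); last by field.
  move=> H3 H2 H1.
  have := nrmD (f (c (x + s)) - f (c (x + s / 3 + s / 3)))
    (f (c (x + s / 3 + s / 3)) - f (c (x + s / 3))).
  rewrite subrKA => H4.
  have := nrmD (f (c (x + s)) - f (c (x + s / 3))) (f (c (x + s / 3)) - f (c x)).
  rewrite subrKA; lra.
move=> u v /andP[u0 u1] _; rewrite add0r in u1.
have [|L fL LK] := fK u; first by rewrite u0.
have [linL _ fL2] := fL.
have /fL2[d d0 Hd] : 0 < e / (nrm (b - a) + 1) by rewrite divr_gt0 // ltr_wpDl.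
have B1 : 0 < nrm (b - a) + 1 by rewrite ltr_wpDl.
exists (d / (nrm (b - a) + 1)) => [|x y s /andP[s0 sd] /andP[xu us] _].
  by rewrite divr_gt0.
have lip s' : `|s' - u| < d / (nrm (b - a) + 1) -> nrm (f (c s') - f (c u)) <= K1 * `|s' - u|.
  move=> su; pose h := (s' - u)%:C%C *: (b - a).
  have hE : nrm h = `|s' - u| * nrm (b - a) by rewrite nrmZ cabs_real.
  have n0 : 0 <= `|s' - u| by [].
  have hd : nrm h < d.
    rewrite hE; apply: (@le_lt_trans _ _ (`|s' - u| * (nrm (b - a) + 1))).
      by rewrite ler_wpM2l // lerDl.
    by rewrite -ltr_pdivlMr.
  have -> : c s' = c u + h by rewrite /c /h rmorphB /= scalerBl -addrA subrKC.
  rewrite -(subrK (L h) (f _ - _)); apply: (le_trans (nrmD _ _)).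
  have := Hd _ hd; have := LK h; rewrite hE => L1 L2.
  have L3 : e / (nrm (b - a) + 1) * (`|s' - u| * nrm (b - a)) <= e * `|s' - u|.
    rewrite mulrCA mulrC ler_wpM2r // mulrAC ler_pdivrMr //.
    by rewrite ler_wpM2l ?(ltW e0) // lerDl.
  have L4 : K * (`|s' - u| * nrm (b - a)) = K * nrm (b - a) * `|s' - u| by ring.
  by move: L1 L2 L3; rewrite L4 /K1 mulrDl; lra.
have E1 : `|x + s - u| = x + s - u by rewrite ger0_norm; lra.
have E2 : `|x - u| = u - x by rewrite distrC ger0_norm; lra.
have := lip (x + s); have := lip x; rewrite E1 E2 => L2 L1.
have {}L1 : nrm (f (c (x + s)) - f (c u)) <= K1 * (x + s - u) by apply: L1; lra.
have {}L2 : nrm (f (c x) - f (c u)) <= K1 * (u - x) by apply: L2; lra.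
rewrite nrm_subC in L2.
have := nrmD (f (c (x + s)) - f (c u)) (f (c u) - f (c x)); rewrite subrKA.
by move=> H; move: L1 L2; rewrite !mulrBr mulrDr; lra.
Qed.

End Frechet.

(** * Positivity in C*-algebras *)

Section CStarAlgebra.
Variables (R : realType) (A : completeNormedModType R[i]).
Variables (mul : A -> A -> A) (one : A) (star : A -> A).
Hypothesis HA : unital_cstar_algebra mul one star.

Local Notation "a ** b" := (mul a b) (at level 40, left associativity).
Local Notation inv := (is_inverse mul one).
Local Notation "c %:S" := (c%:C%C *: one) (at level 2, format "c %:S").
Implicit Types (a b W U : A) (c e : R).

Lemma cmulBl a b d : (a - b) ** d = a ** d - b ** d.
Proof. by rewrite -scaleN1r (cs_mulDl HA) (cs_mulZl HA) scaleN1r. Qed.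

Lemma cmulBr a b d : a ** (b - d) = a ** b - a ** d.
Proof. by rewrite -scaleN1r (cs_mulDr HA) (cs_mulZr HA) scaleN1r. Qed.

Lemma cmulr0 a : a ** 0 = 0.
Proof. by rewrite -(scale0r a) (cs_mulZr HA) !scale0r. Qed.

Lemma cmul0r a : 0 ** a = 0.
Proof. by rewrite -(scale0r a) (cs_mulZl HA) !scale0r. Qed.

Lemma starN a : star (- a) = - star a.
Proof.
rewrite -[LHS](congr1 star (scaleN1r a)) (cs_starZ HA) -[RHS]scaleN1r.
by congr (_ *: _); apply/eqP; rewrite eq_complex /= !oppr0 !eqxx.
Qed.

Lemma starB a b : star (a - b) = star a - star b.
Proof. by rewrite (cs_starD HA) starN. Qed.

Lemma star_one : star one = one.
Proof.
by rewrite -[LHS](cs_mul1l HA) -{1}(cs_starK HA one) -(cs_starM HA) (cs_mul1l HA) (cs_starK HA).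
Qed.

Lemma star_scaler c a : star (c%:C%C *: a) = c%:C%C *: star a.
Proof. by rewrite (cs_starZ HA) /= oppr0. Qed.

Lemma star_real c : star (c%:S) = c%:S.
Proof. by rewrite star_scaler star_one. Qed.

Lemma nrm_mul a b : nrm (a ** b) <= nrm a * nrm b.
Proof. by have := cs_norm_mul HA a b; rewrite !nrmE -rmorphM lecR. Qed.

Lemma nrm_cstar a : nrm (star a ** a) = nrm a ^+ 2.
Proof.
by have := cs_cstar HA a; rewrite !nrmE -rmorphXn => /complexI.
Qed.

Lemma nrm_star a : nrm (star a) = nrm a.
Proof.
suff H b : nrm b <= nrm (star b).
  apply/eqP; rewrite eq_le; apply/andP; split; last exact: H.
  by have := H (star a); rewrite (cs_starK HA).
have [->|b0] := eqVneq b 0; first by rewrite nrm0 nrm_ge0.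
rewrite -nrm_gt0 in b0; rewrite -(ler_pM2r b0) -expr2 -nrm_cstar.
exact: nrm_mul.
Qed.

Lemma nrm_one : nrm one = 1.
Proof.
have n0 : nrm one != 0 by rewrite nrm_eq0 (cs_one_neq0 HA).
apply: (mulfI n0); rewrite -expr2 -nrm_cstar star_one (cs_mul1l HA) mulr1 //.
Qed.

Lemma nrm_real c : nrm (c%:S) = `|c|.
Proof. by rewrite nrmZ nrm_one mulr1 cabs_real. Qed.

(** * Inverses and the Neumann series *)

Lemma inv_uniq a b d : inv a b -> inv a d -> b = d.
Proof.
move=> [_ ba] [ad _].
by rewrite -(cs_mul1r HA b) -ad (cs_mulA HA) ba (cs_mul1l HA).
Qed.

Lemma ainvE a b : inv a b -> ainv mul one a = b.
Proof.
move=> ab; apply: (inv_uniq _ ab); rewrite /ainv.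
by have := @xgetPex _ a [set b | inv a b] (ex_intro _ b ab).
Qed.

Lemma inv_sym a b : inv a b -> inv b a. Proof. by case. Qed.

Lemma inv_star a b : inv a b -> inv (star a) (star b).
Proof. by move=> [ab ba]; split; rewrite -(cs_starM HA) ?ab ?ba star_one. Qed.

Lemma inv_mul a a' b b' : inv a a' -> inv b b' -> inv (a ** b) (b' ** a').
Proof.
move=> [aa' a'a] [bb' b'b]; split.
  by rewrite (cs_mulA HA) -[a ** b ** b'](cs_mulA HA) bb' (cs_mul1r HA).
by rewrite (cs_mulA HA) -[b' ** a' ** a](cs_mulA HA) a'a (cs_mul1r HA).
Qed.

Lemma inv_scale (k : R[i]) a b : k != 0 -> inv a b -> inv (k *: a) (k^-1 *: b).
Proof.
by move=> k0 [ab ba]; split; rewrite (cs_mulZl HA) (cs_mulZr HA) scalerA ?ab ?ba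
  ?mulfV ?mulVf ?scale1r.
Qed.

Lemma inv_unscale (k : R[i]) a b : k != 0 -> inv (k *: a) b -> inv a (k *: b).
Proof.
move=> k0 /(inv_scale (_ : k^-1 != 0)); rewrite invr_eq0 => /(_ k0).
by rewrite scalerA mulVf // scale1r invrK.
Qed.

(** The partial sums are the iterates of [b |-> one + a ** b] from [0]. They commute with [a], so
    the limit solves the equation on both sides. *)
Lemma neumann a : nrm a < 1 ->
  exists2 b, inv (one - a) b & nrm b <= (1 - nrm a)^-1.
Proof.
move=> a1; pose u n := iter n (fun b => one + a ** b) 0.
have uS n : u n.+1 = one + a ** u n by [].
have comm n : a ** u n = u n ** a.
  elim: n => [|n IH]; first by rewrite cmulr0 cmul0r.
  by rewrite !uS (cs_mulDr HA) (cs_mulDl HA) IH (cs_mulA HA) IH (cs_mul1l HA) (cs_mul1r HA).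
have [|n|b ub] := @geometric_steps _ _ u 1 (nrm a) ler01.
- by rewrite nrm_ge0.
- rewrite mul1r; elim: n => [|n IH].
    by rewrite uS cmulr0 addr0 subr0 nrm_one expr0.
  rewrite [u n.+2]uS [u n.+1]uS opprD addrACA subrr add0r -cmulBr exprS.
  by apply: (le_trans (nrm_mul _ _)); rewrite ler_wpM2l // nrm_ge0.
have lim1 (f : A -> A) : (forall x y, nrm (f x - f y) <= nrm (x - y)) ->
    (forall n, f (u n) = u n.+1) -> f b = b.
  move=> f1 fu; apply: nrm_sub_small => e e0.
  have [|N HN] := ub (e / 2); first by rewrite divr_gt0.
  have := nrmD (f b - f (u N)) (u N.+1 - b); rewrite fu subrKA => /le_trans; apply.
  have := HN _ (leqnSn N); have := HN _ (leqnn N).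
  by have := f1 b (u N); rewrite fu (nrm_subC b) => *; lra.
have bE : one + a ** b = b.
  apply: (lim1 (fun x => one + a ** x)) => // x y.
  rewrite opprD addrACA subrr add0r -cmulBr; apply: (le_trans (nrm_mul _ _)).
  by rewrite ler_piMl ?nrm_ge0 // ltW.
have bE' : one + b ** a = b.
  apply: (lim1 (fun x => one + x ** a)) => [x y|n]; last by rewrite -comm.
  rewrite opprD addrACA subrr add0r -cmulBl; apply: (le_trans (nrm_mul _ _)).
  by rewrite ler_piMr ?nrm_ge0 // ltW.
exists b; first split.
- by rewrite cmulBl (cs_mul1l HA) -{1}bE addrK.
- by rewrite cmulBr (cs_mul1r HA) -{1}bE' addrK.
have : nrm b <= 1 + nrm a * nrm b.
  rewrite -{1}bE; apply: (le_trans (nrmD _ _)).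
  by rewrite nrm_one lerD2l nrm_mul.
rewrite -[(1 - nrm a)^-1]mul1r ler_pdivlMr ?subr_gt0 //; lra.
Qed.

Lemma inv_near c b : nrm b < c ->
  exists2 y, inv (c%:S - b) y & nrm y <= (c - nrm b)^-1.
Proof.
move=> bc; have c0 : 0 < c := le_lt_trans (nrm_ge0 b) bc.
have cC : c%:C%C != 0 by rewrite -cabs_gt0 cabs_real gtr0_norm.
have ci : 0 <= c^-1 by rewrite invr_ge0 ltW.
have E : nrm ((c^-1)%:C%C *: b) = c^-1 * nrm b by rewrite nrmZr.
have [|y yi yn] := @neumann ((c^-1)%:C%C *: b).
  by rewrite E mulrC ltr_pdivrMr // mul1r.
exists ((c^-1)%:C%C *: y).
  have := inv_scale cC yi; rewrite scalerBr scalerA -rmorphM mulfV ?gt_eqF //.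
  by rewrite scale1r fmorphV.
rewrite nrmZr //; apply: (le_trans (ler_wpM2l ci yn)); rewrite E -invfM.
by rewrite mulrBr mulr1 mulrA mulfV ?gt_eqF // mul1r.
Qed.

Lemma inv_perturb a b d : inv a b -> nrm d * nrm b < 1 ->
  exists2 y, inv (a - d) y & nrm y <= nrm b / (1 - nrm d * nrm b).
Proof.
move=> ab db; have nb : nrm (d ** b) <= nrm d * nrm b := nrm_mul _ _.
have [|z zi zn] := @neumann (d ** b); first exact: le_lt_trans nb db.
exists (b ** z).
  have -> : a - d = (one - d ** b) ** a.
    by rewrite cmulBl (cs_mul1l HA) -(cs_mulA HA) ab.2 (cs_mul1r HA).
  exact: inv_mul.
apply: (le_trans (nrm_mul _ _)); rewrite ler_wpM2l ?nrm_ge0 //.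
apply: (le_trans zn); rewrite lef_pV2 ?posrE; lra.
Qed.

(** * Lower bounds of the real part in terms of the norm *)

Lemma le_sqr (x y : R) : 0 <= x -> x <= y -> x ^+ 2 <= y ^+ 2.
Proof. by move=> x0 xy; rewrite !expr2; apply: ler_pM. Qed.

(* [acc W e] says [Re W >= e] in terms of the norm alone. *)
Definition acc W e := exists K, forall c, 0 <= c ->
  nrm (c%:S - W) ^+ 2 <= c ^+ 2 - 2 * c * e + K.

(** Split [c] into halves and use [(y + z)^2 <= 2 y^2 + 2 z^2]; the leading terms recombine exactly
    to [c^2]. *)
Lemma acc_add W W' e e' : acc W e -> acc W' e' -> acc (W + W') (e + e').
Proof.
move=> [K HK] [K' HK']; exists (2 * K + 2 * K') => c c0.
have c2 : 0 <= c / 2 by rewrite divr_ge0.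
have -> : c%:S - (W + W') = (c / 2)%:S - W + ((c / 2)%:S - W').
  by rewrite addrACA -opprD -scalerDl -rmorphD -splitr.
have := HK _ c2; have := HK' _ c2; have := nrmD ((c / 2)%:S - W) ((c / 2)%:S - W').
have := nrm_ge0 ((c / 2)%:S - W + ((c / 2)%:S - W')).
move: (nrm _) (nrm _) (nrm _) (nrm_ge0 ((c / 2)%:S - W)) (nrm_ge0 ((c / 2)%:S - W')).
move=> x y z y0 z0 x0 xyz H1 H2.
have := le_sqr x0 xyz.
have : 0 <= (y - z) ^+ 2 by exact: sqr_ge0.
nra.
Qed.

Lemma acc_scale W e (t : R) : 0 < t -> acc W e -> acc (t%:C%C *: W) (t * e).
Proof.
move=> t0 [K HK]; exists (t ^+ 2 * K) => c c0.
have ct : 0 <= c / t by rewrite divr_ge0 // ltW.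
have -> : c%:S - t%:C%C *: W = t%:C%C *: ((c / t)%:S - W).
  by rewrite scalerBr scalerA -rmorphM mulrC divfK // gt_eqF.
rewrite nrmZr ?(ltW t0) // exprMn.
have /le_trans -> // := ler_wpM2l (sqr_ge0 t) (HK _ ct).
by rewrite le_eqVlt; apply/orP; left; apply/eqP; field; rewrite gt_eqF.
Qed.

Lemma acc_le W e e' : e' <= e -> acc W e -> acc W e'.
Proof.
by move=> ee' [K HK]; exists K => c c0; apply: (le_trans (HK c c0)); nra.
Qed.

Lemma acc_small W e : nrm W <= e -> acc W (- e).
Proof.
move=> We; exists (e ^+ 2) => c c0.
have -> : c ^+ 2 - 2 * c * - e + e ^+ 2 = (c + e) ^+ 2 by ring.
have e0 : 0 <= e := le_trans (nrm_ge0 _) We.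
apply: le_sqr; first exact: nrm_ge0.
by apply: (le_trans (nrmB _ _)); rewrite nrm_real ger0_norm // lerD2l.
Qed.

Lemma acc_real (r : R) : acc (r%:S) r.
Proof.
exists (r ^+ 2) => c c0; rewrite -scalerBl -rmorphB nrm_real real_normK ?num_real //.
by rewrite le_eqVlt; apply/orP; left; apply/eqP; ring.
Qed.

Lemma acc_star W e : acc W e -> acc (star W) e.
Proof.
by move=> [K HK]; exists K => c c0; rewrite -star_real -starB nrm_star HK.
Qed.

(** The cross terms cancel: [|c - i k|^2 = |c^2 + k^2|]. *)
Lemma acc_imag k : star k = k -> acc ('i%C *: k) 0.
Proof.
move=> sk; exists (nrm k ^+ 2) => c c0.
rewrite -nrm_cstar starB star_real (cs_starZ HA) sk.
have -> : (c%:S - conjc 'i%C *: k) ** (c%:S - 'i%C *: k) = (c ^+ 2)%:S + k ** k.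
  rewrite cmulBl !cmulBr !(cs_mulZl HA) !(cs_mulZr HA) !(cs_mul1l HA) !(cs_mul1r HA).
  have -> : conjc 'i%C = - 'i%C :> R[i] by apply/eqP; rewrite eq_complex /= oppr0 !eqxx.
  rewrite !scaleNr !opprK opprD opprK !scalerA ['i%C * c%:C%C]mulrC addrA subrK.
  have -> : 'i%C * 'i%C = -1 :> R[i] by rewrite -expr2 sqr_i.
  by rewrite scaleN1r opprK expr2 rmorphM.
apply: (le_trans (nrmD _ _)); rewrite nrm_real ger0_norm ?sqr_ge0 // mulr0 subr0.
by rewrite lerD2l (le_trans (nrm_mul _ _)) // expr2.
Qed.

(** For large [c] one has [|c - W| < c], so [W] is a perturbation of [c]. For the sharp bound put
    [p = 1 / |y|]: then [r y = 1 + (r - W) y] gives [|r - W| >= r - p], and if [p < e] this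
    contradicts [acc] for large [r]. *)
Lemma acc_inv W e : 0 < e -> acc W e -> exists2 y, inv W y & nrm y <= e^-1.
Proof.
move=> e0 [K HK].
have big (K1 : R) : exists c, 0 < c /\ K1 < c * e.
  exists ((`|K1| + 1) / e); split; first by rewrite divr_gt0 // ltr_wpDl.
  rewrite divfK ?gt_eqF //; have := ler_norm K1; lra.
have [c [c0 cK]] := big K.
have nc : nrm (c%:S - W) < c.
  rewrite ltNge; apply/negP => /(le_sqr (ltW c0)).
  by have := HK c (ltW c0); have := mulr_gt0 c0 e0; lra.
have [y yi _] := inv_near nc; rewrite subKr in yi; exists y => //.
have [//|ye] := leP (nrm y) e^-1; exfalso.
have y0 : 0 < nrm y by apply: lt_trans ye; rewrite invr_gt0.
pose p := (nrm y)^-1.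
have p0 : 0 < p by rewrite invr_gt0.
have pe : p < e by rewrite -[e]invrK ltf_pV2 ?posrE ?invr_gt0.
have ep : 0 < e - p by rewrite subr_gt0.
have H (r : R) : 0 < r -> p <= r -> 2 * r * (e - p) <= K.
  move=> r0 pr; have H1 : r * nrm y <= 1 + nrm (r%:S - W) * nrm y.
    rewrite -nrmZr ?(ltW r0) // (_ : r%:C%C *: y = one + (r%:S - W) ** y).
      by apply: (le_trans (nrmD _ _)); rewrite nrm_one lerD2l nrm_mul.
    by rewrite cmulBl (cs_mulZl HA) (cs_mul1l HA) yi.1 addrC subrK.
  have H2 : r - p <= nrm (r%:S - W).
    rewrite -(ler_pM2r y0) mulrBl [p * _]mulVf ?gt_eqF //; lra.
  have : (r - p) ^+ 2 <= nrm (r%:S - W) ^+ 2.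
    by apply: le_sqr; rewrite ?subr_ge0.
  have := HK r (ltW r0); nra.
pose r := `|K| / (e - p) + p.
have r0 : 0 < r by rewrite ltr_wpDl // divr_ge0 // ltW.
have := H r r0; rewrite lerDr divr_ge0 ?(ltW ep) // => /(_ isT).
have -> : 2 * r * (e - p) = 2 * `|K| + 2 * p * (e - p).
  by rewrite /r; field; rewrite gt_eqF.
have := ler_norm K; have := normr_ge0 K.
have : 0 < 2 * p * (e - p) by rewrite !mulr_gt0.
lra.
Qed.

Lemma acc_shift W e (r : R) : acc W e -> acc (W - r%:S) (e - r).
Proof.
by move=> We; rewrite -scaleNr -rmorphN; apply: acc_add => //; exact: acc_real.
Qed.

Lemma acc_Re W e : acc W e -> acc (ReA star W) e.
Proof.
move=> We; rewrite /ReA (_ : e = 2^-1 * (e + e)); last by field.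
have -> : (2%:R : R[i])^-1 = (2^-1)%:C%C by rewrite fmorphV rmorph_nat.
by apply: acc_scale; [rewrite invr_gt0 | apply: acc_add => //; exact: acc_star].
Qed.

Lemma star_ReA W : star (ReA star W) = ReA star W.
Proof.
rewrite /ReA (_ : (2%:R : R[i])^-1 = (2^-1)%:C%C); last by rewrite fmorphV rmorph_nat.
by rewrite star_scaler (cs_starD HA) (cs_starK HA) addrC.
Qed.

Lemma double_ReA W : W + star W = 2%:C%C *: ReA star W.
Proof.
rewrite /ReA scalerA (_ : 2%:C%C * _ = 1) ?scale1r //.
by rewrite rmorph_nat mulfV // pnatr_eq0.
Qed.

(** [|c - W|^2] is the norm of [2 c (c / 2 - Re W) + W^* W]. With [n = |c / 2 - Re W|], the
    inequality [2 c n <= 2 n^2 + c^2 / 2] brings in the hypothesis at [c / 2]. *)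
Lemma ReA_acc W e : acc (ReA star W) e -> acc W e.
Proof.
move=> [K HK]; exists (nrm W ^+ 2 + 2 * `|K|) => c c0.
have N0 := sqr_ge0 (nrm W); have KK := ler_norm K; have K0 := normr_ge0 K.
have [->|cn] := eqVneq c 0.
  rewrite (_ : 0%:C%C = 0 :> R[i]) // scale0r sub0r nrmN.
  by rewrite mulr0 mul0r subr0 expr0n add0r lerDl mulr_ge0.
have {cn}c0 : 0 < c by rewrite lt0r cn.
rewrite -nrm_cstar starB star_real cmulBl !cmulBr !(cs_mulZl HA) !(cs_mulZr HA).
rewrite !(cs_mul1l HA) (cs_mul1r HA).
have -> : c%:C%C *: c%:S - c%:C%C *: W - (c%:C%C *: star W - star W ** W) =
    (2 * c)%:C%C *: ((c / 2)%:S - ReA star W) + star W ** W.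
  rewrite opprB addrCA addrC; congr (_ + _).
  rewrite [RHS]scalerBr [in RHS]scalerA -[in RHS]rmorphM (_ : 2 * c * (c / 2) = c * c); last by field.
  rewrite (mulrC 2 c) (rmorphM _ c 2) -[X in _ = _ - X]scalerA -double_ReA.
  by rewrite scalerDr opprD addrA scalerA -rmorphM.
apply: (le_trans (nrmD _ _)); rewrite nrm_cstar nrmZr; last by rewrite mulr_ge0 ?ltW.
set n := nrm (_ - _); have n0 : 0 <= n := nrm_ge0 _.
have := HK (c / 2) (divr_ge0 (ltW c0) (ler0n _ _)); rewrite -/n => Hn.
have : 0 <= (n - c / 2) ^+ 2 by exact: sqr_ge0.
nra.
Qed.

(** Multiplying [a - l] by [i] or [- i] gives [|Im l| + i b] with [b] selfadjoint, to which
    [acc_inv] applies. *)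
Lemma sa_nonreal a (l : R[i]) : star a = a -> complex.Im l != 0 ->
  exists2 y, inv (a - l *: one) y & nrm y <= `|complex.Im l|^-1.
Proof.
case: l => x t /= sa t0.
have lE : (x +i* t)%C = x%:C%C + 'i%C * t%:C%C.
  by apply/eqP; rewrite eq_complex /=; apply/andP; split; apply/eqP; ring.
have H (k : R[i]) q b : cabs k = 1 -> 0 < q -> star b = b ->
    k *: (a - (x +i* t)%C *: one) = q%:S + 'i%C *: b ->
    exists2 y, inv (a - (x +i* t)%C *: one) y & nrm y <= q^-1.
  move=> k1 q0 sb kE.
  have := acc_add (acc_real q) (acc_imag sb); rewrite -kE addr0.
  move=> /(acc_inv q0)[y yi yn]; exists (k *: y).
    by apply: inv_unscale => //; rewrite -cabs_gt0 k1.
  by rewrite nrmZ k1 mul1r.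
have ii : 'i%C * 'i%C = -1 :> R[i] by rewrite -expr2 sqr_i.
have [tn|tp] := ltP t 0.
  rewrite ltr0_norm //; apply: (H (- 'i%C) (- t) (x%:S - a)).
  - by rewrite cabsN cabs_i.
  - by rewrite oppr_gt0.
  - by rewrite starB star_real sa.
  rewrite lE scaleNr -scalerN opprB scalerDl addrAC scalerDr.
  by rewrite [LHS]addrC scalerA mulrA ii mulN1r -rmorphN.
have {tp}tp : 0 < t by rewrite lt0r t0.
rewrite gtr0_norm //; apply: (H 'i%C t (a - x%:S)) => //.
- exact: cabs_i.
- by rewrite starB star_real sa.
by rewrite lE scalerDl opprD addrA scalerBr [LHS]addrC scalerA mulrA ii mulN1r scaleNr opprK.
Qed.

Lemma sa_cge a e : star a = a ->
  (forall r : R, r < e -> invertible mul one (a - r%:S)) -> cge mul one star a (e%:S).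
Proof.
move=> sa H; split; first by rewrite /selfadjoint starB sa star_real.
move=> l; rewrite /spectrum /= -addrA -opprD -scalerDl => nl.
have [l0|l0] := eqVneq (complex.Im l) 0; last first.
  have [|y yi _] := @sa_nonreal a (e%:C%C + l) sa; last by case: nl; exists y.
  by case: l l0 {nl} => x t /=; rewrite add0r.
case: l l0 nl => x t /= -> nl; rewrite lecE /= eqxx /= leNgt; apply/negP => x0.
apply: nl; have -> : e%:C%C + x%:C%C = (e + x)%:C%C by rewrite rmorphD.
by apply: H; lra.
Qed.

Lemma acc_cge a e : star a = a -> acc a e -> cge mul one star a (e%:S).
Proof.
move=> sa ae; apply: sa_cge => // r re.
have [||y yi _] := @acc_inv (a - r%:S) (e - r); first by rewrite subr_gt0.
  exact: acc_shift.
by exists y.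
Qed.

Lemma fder_ainv U y : inv U y -> fder (ainv mul one) U (fun h => - (y ** h ** y)).
Proof.
move=> Uy; split.
- move=> k u v; rewrite (cs_mulDr HA) (cs_mulDl HA) (cs_mulZr HA) (cs_mulZl HA).
  by rewrite opprD scalerN.
- exists (nrm y * nrm y) => [|h]; first by rewrite mulr_ge0 ?nrm_ge0.
  rewrite nrmN mulrAC; apply: (le_trans (nrm_mul _ _)).
  by rewrite ler_wpM2r ?nrm_ge0 // nrm_mul.
move=> e e0; have n0 := nrm_ge0 y; pose Y := nrm y + 1.
have Y0 : 0 < Y by rewrite ltr_wpDl.
have YY : nrm y <= Y by rewrite lerDl.
(* The first bound gives [|y'| <= 2 Y] for the new inverse; the second makes the error [y' h y h y]
   at most [e |h|]. *)
exists (Num.min (Y^-1 / 2) (e / (2 * Y ^+ 3))).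
  by rewrite lt_min !divr_gt0 ?invr_gt0 ?mulr_gt0 ?exprn_gt0.
move=> h; rewrite lt_min => /andP[h1 h2]; have h0 := nrm_ge0 h.
have hy : nrm h * nrm y <= 2^-1.
  apply: (@le_trans _ _ (Y^-1 / 2 * Y)); last by rewrite mulrAC mulVf ?mul1r ?gt_eqF.
  by apply: ler_pM => //; exact: ltW.
have [|y' y'i y'n] := @inv_perturb U y (- h) Uy; first by rewrite nrmN; lra.
rewrite opprK nrmN in y'i y'n.
have {}y'n : nrm y' <= 2 * Y.
  apply: (le_trans y'n); rewrite ler_pdivrMr; last by lra.
  by nra.
rewrite (ainvE y'i) (ainvE Uy) opprK.
have dE : y' - y = - (y' ** h ** y).
  have : y' ** (U + h) ** y = y by rewrite y'i.2 (cs_mul1l HA).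
  rewrite (cs_mulDr HA) (cs_mulDl HA) -(cs_mulA HA) Uy.1 (cs_mul1r HA).
  by move=> /eqP; rewrite addrC eq_sym -subr_eq => /eqP <-; rewrite opprB.
have -> : y' - y + y ** h ** y = y' ** h ** y ** h ** y.
  by rewrite -[y' ** h ** y]opprK -dE opprB !cmulBl dE addrC.
have H u v (B C : R) : nrm u <= B -> nrm v <= C -> nrm (u ** v) <= B * C.
  by move=> uB vC; apply: (le_trans (nrm_mul _ _)); apply: ler_pM; rewrite ?nrm_ge0.
apply: (@le_trans _ _ (2 * Y * nrm h * Y * nrm h * Y)).
  apply: (H _ _ _ _ _ YY); apply: (H _ _ _ _ _ (lexx _)); apply: (H _ _ _ _ _ YY).
  exact: (H _ _ _ _ y'n (lexx _)).
have -> : 2 * Y * nrm h * Y * nrm h * Y = (nrm h * (2 * Y ^+ 3)) * nrm h by ring.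
by rewrite ler_wpM2r // -ler_pdivlMr ?mulr_gt0 ?exprn_gt0 // ltW.
Qed.

(** * Norm and spectrum of selfadjoint elements *)

Lemma cabs_sqr (z : R[i]) : cabs z ^+ 2 = complex.Re z ^+ 2 + complex.Im z ^+ 2.
Proof. by apply: complexI; rewrite add_Re2_Im2 cabsE rmorphXn. Qed.

Lemma Im_inv (z : R[i]) : complex.Im z^-1 = - complex.Im z / cabs z ^+ 2.
Proof. by rewrite cabs_sqr; case: z => x y /=; rewrite mulNr. Qed.

Lemma resolvent_nonreal b (mu : R[i]) : star b = b -> complex.Im mu != 0 ->
  exists2 y, inv (one - mu *: b) y & nrm y <= cabs mu / `|complex.Im mu|.
Proof.
move=> sb t0; have m0 : mu != 0 by apply: contra_neq t0 => ->.
have c0 : 0 < cabs mu by rewrite cabs_gt0.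
have [|y yi yn] := @sa_nonreal b mu^-1 sb.
  by rewrite Im_inv mulf_neq0 ?oppr_eq0 // invr_eq0 expf_neq0 ?gt_eqF.
have Nm0 : - mu != 0 by rewrite oppr_eq0.
exists ((- mu)^-1 *: y).
  have := inv_scale Nm0 yi; rewrite scalerBr scalerA mulNr mulfV // scaleNr scaleN1r.
  by rewrite opprK addrC.
rewrite nrmZ cabsV cabsN mulrC ler_pdivrMr //; apply: (le_trans yn).
rewrite Im_inv normrM normrN normfV [`|_ ^+ 2|]ger0_norm ?sqr_ge0 // invfM invrK.
by rewrite expr2 mulrC mulrAC.
Qed.

(** The disc of radius [1 + h] is covered by three regions: away from the real axis
    [resolvent_nonreal] applies, on the middle strip the Neumann series, and near 1 and -1 a
    perturbation of [one - b] and [one + b]. The choice [h <= 1 / (3 K0)] keeps that perturbation at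
    most 1/2. *)
Lemma resolvent_bound b p q : star b = b -> nrm b = 1 ->
  inv (one - b) p -> inv (one + b) q ->
  exists K r, 1 < r /\ forall mu : R[i], cabs mu <= r ->
    exists2 y, inv (one - mu *: b) y & nrm y <= K.
Proof.
move=> sb b1 pi qi; pose K0 := nrm p + nrm q + 1.
have p0 := nrm_ge0 p; have q0 := nrm_ge0 q.
have K00 : 0 < K0 by rewrite /K0; lra.
pose h := Num.min 1 (3 * K0)^-1.
have h0 : 0 < h by rewrite lt_min ltr01 invr_gt0 mulr_gt0.
have h1 : h <= 1 by rewrite ge_min lexx.
have hK : h * K0 <= 3^-1.
  by rewrite -ler_pdivlMr // -invfM ge_min lexx orbT.
have i0 : 0 < h^-1 by rewrite invr_gt0.
exists (4 * h^-1 + 2 * K0), (1 + h); split; first by lra.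
move=> mu mur.
have [tb|ts] := leP (h / 2) `|complex.Im mu|.
  have t0 : 0 < `|complex.Im mu| by lra.
  have [|y yi yn] := @resolvent_nonreal b mu sb; first by rewrite -normr_gt0.
  exists y => //; apply: (le_trans yn); rewrite ler_pdivrMr //.
  apply: (@le_trans _ _ ((4 * h^-1 + 2 * K0) * (h / 2))); last first.
    by rewrite ler_wpM2l //; lra.
  have -> : (4 * h^-1 + 2 * K0) * (h / 2) = 2 + K0 * h by field; rewrite gt_eqF.
  by have := mulr_gt0 K00 h0; lra.
have xb : `|complex.Re mu| <= 1 + h := le_trans (Re_le_cabs _) mur.
have [xs|xl] := leP `|complex.Re mu| (1 - h).
  have m1 : nrm (mu *: b) <= 1 - h / 2.
    by rewrite nrmZ b1 mulr1; apply: (le_trans (cabs_le_ReIm _)); lra.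
  have [|y yi yn] := @neumann (mu *: b); first by lra.
  exists y => //; apply: (le_trans yn).
  apply: (@le_trans _ _ (h / 2)^-1).
    by rewrite lef_pV2 ?posrE; lra.
  by rewrite invfM invrK; lra.
have near (s : R[i]) b' p' : b' = one - s *: b -> inv b' p' -> nrm p' <= K0 ->
    cabs (mu - s) <= 3 / 2 * h -> exists2 y, inv (one - mu *: b) y & nrm y <= 4 * h^-1 + 2 * K0.
  move=> b'E b'i p'K sK; have sp : nrm ((mu - s) *: b) * nrm p' <= 2^-1.
    rewrite nrmZ b1 mulr1; apply: (@le_trans _ _ (3 / 2 * h * K0)); last by lra.
    by apply: ler_pM; rewrite ?cabs_ge0 ?nrm_ge0.
  have [|y yi yn] := @inv_perturb b' p' ((mu - s) *: b) b'i; first by lra.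
  exists y; first by move: yi; rewrite b'E -addrA -opprD -scalerDl subrKC.
  apply: (le_trans yn); rewrite ler_pdivrMr; last by lra.
  by have := nrm_ge0 p'; nra.
have [x0|x0] := ltP 0 (complex.Re mu).
  rewrite gtr0_norm // in xb xl; apply: (near 1 (one - b) p) => //.
  - by rewrite scale1r.
  - by rewrite /K0; lra.
  apply: (le_trans (cabs_le_ReIm _)).
  have -> : complex.Re (mu - 1) = complex.Re mu - 1 by case: (mu).
  have -> : complex.Im (mu - 1) = complex.Im mu by case: (mu) => ? ? /=; rewrite subr0.
  have : `|complex.Re mu - 1| <= h by rewrite ler_norml; apply/andP; split; lra.
  by lra.
rewrite ler0_norm // in xb xl; apply: (near (-1) (one + b) q) => //.
- by rewrite scaleN1r opprK.
- by rewrite /K0; lra.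
apply: (le_trans (cabs_le_ReIm _)); rewrite opprK.
have -> : complex.Re (mu + 1) = complex.Re mu + 1 by case: (mu).
have -> : complex.Im (mu + 1) = complex.Im mu by case: (mu) => ? ? /=; rewrite addr0.
have : `|complex.Re mu + 1| <= h by rewrite ler_norml; apply/andP; split; lra.
by lra.
Qed.

(* [(1 - nu^2 b^2)^-1] is the mean of [(1 - nu b)^-1] and [(1 + nu b)^-1]. *)
Lemma resolvent_square b K r (mu : R[i]) :
  (forall nu : R[i], cabs nu <= r -> exists2 y, inv (one - nu *: b) y & nrm y <= K) ->
  0 <= r -> cabs mu <= r ^+ 2 ->
  exists2 y, inv (one - mu *: (b ** b)) y & nrm y <= K.
Proof.
move=> H r0 mur; pose nu := sqrtc mu.
have nuE : nu ^+ 2 = mu := sqr_sqrtc mu.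
have nur : cabs nu <= r.
  rewrite leNgt; apply/negP => rnu.
  have : r ^+ 2 < cabs nu ^+ 2 by rewrite !expr2; apply: ltr_pM.
  by rewrite -cabsX nuE ltNge mur.
have [y1 i1 n1] := H nu nur.
have [|y2 i2 n2] := H (- nu); first by rewrite cabsN.
rewrite scaleNr opprK in i2.
have E1 : one - mu *: (b ** b) = (one - nu *: b) ** (one + nu *: b).
  rewrite cmulBl !(cs_mulDr HA) !(cs_mul1l HA) (cs_mul1r HA) (cs_mulZl HA) (cs_mulZr HA).
  by rewrite opprD addrA addrK scalerA -expr2 nuE.
have E2 : one - mu *: (b ** b) = (one + nu *: b) ** (one - nu *: b).
  rewrite cmulBr !(cs_mulDl HA) !(cs_mul1l HA) (cs_mul1r HA) (cs_mulZl HA) (cs_mulZr HA).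
  by rewrite opprD addrA addrK scalerA -expr2 nuE.
have i12 : inv (one - mu *: (b ** b)) (y2 ** y1) by rewrite E1; exact: inv_mul.
have hh : (one + nu *: b) + (one - nu *: b) = 2%:S.
  by rewrite addrACA subrr addr0 rmorph_nat scaler_nat mulr2n.
have half (z : A) : (2^-1)%:C%C *: (2%:C%C *: z) = z.
  by rewrite scalerA -rmorphM mulVf ?scale1r ?pnatr_eq0.
have yE : y2 ** y1 = (2^-1)%:C%C *: (y1 + y2).
  have i21 : inv (one - mu *: (b ** b)) (y1 ** y2) by rewrite E2; exact: inv_mul.
  have -> : y1 + y2 = y2 ** ((one + nu *: b) + (one - nu *: b)) ** y1.
    by rewrite (cs_mulDr HA) (cs_mulDl HA) i2.2 (cs_mul1l HA) -(cs_mulA HA) i1.1 (cs_mul1r HA).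
  by rewrite hh (cs_mulZr HA) (cs_mul1r HA) (cs_mulZl HA) half.
exists (y2 ** y1) => //; rewrite yE nrmZr ?invr_ge0 //.
by have := nrmD y1 y2; lra.
Qed.

Lemma bernoulli_pow (r : R) n : 0 <= r -> 1 + r * n%:R <= (1 + r) ^+ n.
Proof.
move=> r0; elim: n => [|n IH]; first by rewrite mulr0 addr0 expr0.
have n0 : 0 <= (n%:R : R) by [].
have rn : 0 <= r * r * n%:R by rewrite !mulr_ge0.
rewrite exprS; apply: le_trans (ler_wpM2l _ IH); last by lra.
rewrite -natr1; lra.
Qed.

(* Gelfand's formula for a selfadjoint element, in the form that [1] or [-1]
   lies in the spectrum: otherwise the resolvent [(1 - mu b)^-1] is bounded on a
   disc of radius [r > 1], hence so is [(1 - mu b^(2^n))^-1] on a disc of radius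
   [r^(2^n)], and Cauchy's estimate forces [b^(2^n) -> 0]. *)
Lemma sa_norm_spectrum b p q : star b = b -> nrm b = 1 ->
  inv (one - b) p -> inv (one + b) q -> False.
Proof.
move=> sb b1 pi qi; have [K [r [r1 HK]]] := resolvent_bound sb b1 pi qi.
have r0 : 0 <= r by lra.
pose e n := iter n (fun x => x ** x) b.
have eS n : star (e n) = e n /\ nrm (e n) = 1.
  elim: n => [|n [IH1 IH2]] //=; rewrite (cs_starM HA) IH1; split => //.
  by rewrite -{1}IH1 nrm_cstar IH2 expr1n.
have eB n (mu : R[i]) : cabs mu <= r ^+ (2 ^ n) ->
    exists2 y, inv (one - mu *: e n) y & nrm y <= K.
  elim: n mu => [|n IH] mu; first by rewrite expn0 expr1; exact: HK.
  rewrite expnSr exprM => H; apply: resolvent_square IH _ H.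
  exact: exprn_ge0.
have bound n : r ^+ (2 ^ n) <= 8 * K.
  (* The half accounts for the modulus of [z], at most 2 on the square. The derivative of [g] at [0]
     is [T e_n], of norm [T], so the Cauchy estimate gives [T <= 4 K]. *)
  have [_ en1] := eS n; pose T := r ^+ (2 ^ n) / 2.
  have T0 : 0 < T by rewrite divr_gt0 // exprn_gt0 //; lra.
  have sqT (z : R[i]) : square (-1) (-1) 2 z ->
      exists2 y, inv (one + z *: - (T%:C%C *: e n)) y & nrm y <= K.
    move=> [/andP[z1 z2] /andP[z3 z4]].
    have [|y yi yn] := eB n (z * T%:C%C).
      rewrite cabsM cabs_real gtr0_norm //.
      have : cabs z <= 2.
        apply: (le_trans (cabs_le_ReIm _)).
        have : `|complex.Re z| <= 1 by rewrite ler_norml; apply/andP; split; lra.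
        by have : `|complex.Im z| <= 1 by [rewrite ler_norml; apply/andP; split; lra]; lra.
      move=> c2; have -> : r ^+ (2 ^ n) = 2 * T by rewrite /T; field.
      by rewrite ler_wpM2r // ltW.
    by exists y => //; rewrite scalerN scalerA.
  pose g z := ainv mul one (one + z *: - (T%:C%C *: e n)).
  have : nrm (- (one ** - (T%:C%C *: e n) ** one)) <= 4 * K.
    apply: (@cauchy_estimate _ _ g).
    - move=> z /sqT[y yi yn]; eexists; exact: fder_line (fder_ainv yi).
    - by move=> z /sqT[y yi yn]; rewrite /g (ainvE yi).
    - apply: (@fder_line _ _ _ _ _ 0 (fun h => - (one ** h ** one))).
      by apply: fder_ainv; rewrite scale0r addr0; split; rewrite (cs_mul1l HA).
  rewrite (cs_mul1l HA) (cs_mul1r HA) opprK nrmZr ?(ltW T0) // en1 mulr1 /T; lra.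
have r10 : 0 < r - 1 by rewrite subr_gt0.
pose n := Num.bound `|8 * K / (r - 1)|.
have Kn : 8 * K < (r - 1) * n%:R.
  rewrite [ltRHS]mulrC -ltr_pdivrMr //; apply: (le_lt_trans (ler_norm _)).
  exact: archi_boundP (normr_ge0 _).
have := bound n; rewrite leNgt => /negP; apply; apply: (lt_le_trans Kn).
rewrite (_ : r = 1 + (r - 1)); last by ring.
apply: le_trans (bernoulli_pow _ (ltW r10)).
have n2 : (n%:R : R) <= (2 ^ n)%:R by rewrite ler_nat ltnW // ltn_expl.
rewrite addrAC subrr add0r; nra.
Qed.

(** The point is [|c - a| <= c] for [c >= |a|]. Otherwise let [b = c - a] and [be = |b| > c]:
    [be - b = a - (c - be)] is invertible because [c - be < 0] is off the spectrum, and [be + b]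
    because [|a| < be + c]. This contradicts [sa_norm_spectrum] for [b / be]. *)
Lemma cpos_acc a : cpos mul one star a -> acc a 0.
Proof.
move=> [sa spa].
have inv_neg (l : R) : l < 0 -> invertible mul one (a - l%:S).
  by move=> l0; apply: contrapT => /spa; rewrite lecR leNgt l0.
suff H c : nrm a <= c -> nrm (c%:S - a) <= c.
  exists (4 * nrm a ^+ 2) => c c0; rewrite mulr0 subr0.
  have [/H|ac] := leP (nrm a) c.
    have := nrm_ge0 (c%:S - a); have := sqr_ge0 (nrm a); nra.
  have := nrmB (c%:S) a; rewrite nrm_real ger0_norm // => H2.
  by have := nrm_ge0 (c%:S - a); nra.
move=> ac; rewrite leNgt; apply/negP.
pose b := c%:S - a; rewrite -/b; set be := nrm b => cb.
have c0 : 0 <= c := le_trans (nrm_ge0 _) ac.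
have be0 : 0 < be by lra.
have beC : be%:C%C != 0 by rewrite -cabs_gt0 cabs_real gtr0_norm.
pose b' := (be^-1)%:C%C *: b.
have bE : b = be%:C%C *: b' by rewrite /b' scalerA -rmorphM mulfV ?gt_eqF // scale1r.
have unit_of (x y : A) : be%:C%C *: x = y -> invertible mul one y -> exists z, inv x z.
  by move=> <- [z zi]; exists (be%:C%C *: z); exact: inv_unscale.
have [||p pi] := @unit_of (one - b') (a - (c - be)%:S).
- by rewrite scalerBr -bE /b rmorphB scalerBl !opprB addrCA.
- by apply: inv_neg; lra.
have [||q qi] := @unit_of (one + b') ((be + c)%:S - a).
- by rewrite scalerDr -bE /b addrA -scalerDl rmorphD.
- have [|y yi _] := @inv_near (be + c) a; first by lra.
  by exists y.
apply: (sa_norm_spectrum _ _ pi qi).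
- by rewrite /b' star_scaler /b starB star_real sa.
- by rewrite /b' nrmZr ?invr_ge0 ?(ltW be0) // mulVf // gt_eqF.
Qed.

(** * The order through [acc], and real parts of inverses *)

Lemma cge_acc W e : cge mul one star (ReA star W) (e%:S) <-> acc W e.
Proof.
split=> [/cpos_acc H|We]; last by apply: acc_cge (star_ReA W) (acc_Re We).
apply: ReA_acc; rewrite -(subrK (e%:S) (ReA star W)) -[X in acc _ X]add0r.
by apply: acc_add H (acc_real e).
Qed.

Lemma AplusP W : Aplus mul one star W <-> exists2 e, 0 < e & acc W e.
Proof.
by split=> [[e [e0 /cge_acc We]]|[e e0 /cge_acc We]]; exists e.
Qed.

(* With [t > 0] and [U = t W + 1/(2t)], [Re W + t^2 W* W = U* U - (1/(2t))^2],
   and [|U^-1| < 2t]. *)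
Lemma inv_Re_plus_square W e (t : R) : 0 < e -> acc W e -> 0 < t ->
  invertible mul one (ReA star W + (t ^+ 2)%:C%C *: (star W ** W)).
Proof.
move=> e0 We t0; pose s := (2 * t)^-1; have s0 : 0 < s by rewrite invr_gt0 mulr_gt0.
pose U := t%:C%C *: W + s%:S.
have UE : acc U (t * e + s) by apply: acc_add (acc_scale t0 We) (acc_real s).
have te : 0 < t * e by rewrite mulr_gt0.
have [|Z Ui Zn] := acc_inv _ UE; first by lra.
have sU : star U ** U = (s ^+ 2)%:S + (ReA star W + (t ^+ 2)%:C%C *: (star W ** W)).
  rewrite /U (cs_starD HA) star_scaler star_real (cs_mulDl HA) !(cs_mulDr HA).
  rewrite !(cs_mulZl HA) !(cs_mulZr HA) !(cs_mul1l HA) !(cs_mul1r HA).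
  have ts : t * s = 2^-1 by rewrite /s; field; rewrite gt_eqF.
  have H : t%:C%C *: (s%:C%C *: star W) + s%:C%C *: (t%:C%C *: W) = ReA star W.
    rewrite !scalerA -!rmorphM [s * t]mulrC ts -scalerDr addrC.
    by congr (_ *: _); rewrite fmorphV rmorph_nat.
  rewrite addrA -[_ + _ + s%:C%C *: (t%:C%C *: W)]addrA H [LHS]addrC !scalerA -!rmorphM.
  by rewrite [_ + ReA star W]addrC.
(* [U^* U - s^2 = U^* (1 - s^2 Z^* Z) U] with [Z] the inverse of [U], and [s |Z| < 1] since
   [|Z| <= 1 / (t e + s)]. *)
have [z zi] : invertible mul one (one - (s ^+ 2)%:C%C *: (star Z ** Z)).
  have [|z zi _] := @neumann ((s ^+ 2)%:C%C *: (star Z ** Z)); last by exists z.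
  rewrite nrmZr ?sqr_ge0 // nrm_cstar -exprMn -[X in _ < X](expr1n _ 2).
  have sZ : s * nrm Z < 1.
    rewrite mulrC -ltr_pdivlMr // mul1r; apply: (le_lt_trans Zn).
    by rewrite ltf_pV2 ?posrE; lra.
  have := nrm_ge0 Z => Z0; have : 0 <= s * nrm Z by rewrite mulr_ge0 // ltW.
  by move: (s * nrm Z) sZ => x x1 x0; nra.
have E : ReA star W + (t ^+ 2)%:C%C *: (star W ** W) =
    star U ** (one - (s ^+ 2)%:C%C *: (star Z ** Z)) ** U.
  rewrite cmulBr cmulBl (cs_mul1r HA) sU (cs_mulZr HA) (cs_mulZl HA).
  have -> : star U ** (star Z ** Z) ** U = one.
    rewrite (cs_mulA HA) -(cs_mulA HA) Ui.2 (cs_mul1r HA) -(cs_starM HA) Ui.2.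
    exact: star_one.
  by rewrite [RHS]addrC addKr.
exists (Z ** (z ** star Z)); rewrite E.
by apply: (inv_mul _ Ui); apply: (inv_mul _ zi); exact: inv_star Ui.
Qed.

(** [Re X - r = X^* (Re W - r W^* W) X]. The middle factor is bounded below for
    [0 <= r < e / |W|^2]; for [r < 0], [inv_Re_plus_square] gives its invertibility without appeal
    to the positivity of [W^* W]. *)
Lemma acc_inverse W X e : 0 < e -> acc W e -> inv W X -> acc X (e / nrm W ^+ 2).
Proof.
move=> e0 We WX; have W0 : 0 < nrm W.
  rewrite nrm_gt0; apply/eqP => W0; have [] := WX; rewrite W0 cmul0r => /esym/eqP.
  by rewrite (negPf (cs_one_neq0 HA)).
have WW : 0 < nrm W ^+ 2 by rewrite exprn_gt0.
apply/cge_acc; apply: sa_cge (star_ReA X) _ => r re.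
have key : invertible mul one (ReA star W - r%:C%C *: (star W ** W)).
  have [r0|r0] := leP 0 r.
    have [||y yi _] := @acc_inv (ReA star W - r%:C%C *: (star W ** W)) (e - r * nrm W ^+ 2).
    - by rewrite subr_gt0 -ltr_pdivlMr.
    - apply: acc_add (acc_Re We) (acc_small _).
      by rewrite nrmN nrmZr // nrm_cstar.
    by exists y.
  have s0 : 0 < Num.sqrt (- r) by rewrite sqrtr_gt0 oppr_gt0.
  have := inv_Re_plus_square e0 We s0.
  by rewrite sqr_sqrtr ?oppr_ge0 ?(ltW r0) // rmorphN scaleNr.
have E : ReA star X - r%:S = star X ** (ReA star W - r%:C%C *: (star W ** W)) ** X.
  rewrite cmulBr cmulBl (cs_mulZr HA) (cs_mulZl HA).
  have -> : star X ** (star W ** W) ** X = one.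
    rewrite (cs_mulA HA) -(cs_mulA HA) WX.1 (cs_mul1r HA) -(cs_starM HA) WX.1.
    exact: star_one.
  congr (_ - _); rewrite /ReA (cs_mulZr HA) (cs_mulZl HA); congr (_ *: _).
  rewrite (cs_mulDr HA) (cs_mulDl HA) -(cs_mulA HA) WX.1 (cs_mul1r HA).
  by rewrite -(cs_starM HA) WX.1 star_one (cs_mul1l HA) addrC.
case: key => z zi; rewrite E; exists (W ** (z ** star W)).
apply: (inv_mul _ (inv_sym WX)); apply: (inv_mul _ zi).
exact: inv_star (inv_sym WX).
Qed.

End CStarAlgebra.

(** * Iteration *)

Lemma fder_continuous (R : realType) (E : completeNormedModType R[i]) (f L : E -> E) x :
  fder f x L -> forall e : R, 0 < e -> exists2 d : R, 0 < d &
    forall y, nrm (y - x) < d -> nrm (f y - f x) < e.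
Proof.
move=> [_ [K K0 HK] fL] e e0; have [d d0 Hd] := fL 1 ltr01.
have K1 : 0 < K + 1 by rewrite ltr_wpDl.
exists (Num.min d (e / (K + 1))) => [|y]; first by rewrite lt_min d0 divr_gt0.
rewrite lt_min ltr_pdivlMr // => /andP[yd ye].
have := Hd _ yd; rewrite [x + _]addrC subrK => H.
have := nrmD (f y - f x - L (y - x)) (L (y - x)); rewrite subrK.
by have := HK (y - x); lra.
Qed.

(* Earle-Hamilton: with [x_k = F^k x], the maps [G_k = F + t (F - F x_k)] preserve
   [D] for small [t > 0] and send [x_k] to [x_(k+1)] with derivative
   [(1 + t) F'(x_k)].  Cauchy's estimate for their composition bounds
   [(1 + t)^n (F^n)'(x)] uniformly in [n]. *)
Lemma earle_hamilton (R : realType) (E : completeNormedModType R[i])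
    (F : E -> E) (D S : E -> Prop) (B d : R) :
  0 <= B -> 0 < d ->
  (forall x, D x -> exists L, fder F x L) ->
  (forall x, D x -> S (F x)) ->
  (forall x y, S x -> nrm (y - x) <= d -> D y) ->
  (forall x, D x -> nrm x <= B) ->
  (forall x y (s : R), S x -> S y -> 0 <= s <= 1 -> S (x + s%:C%C *: (y - x))) ->
  exists C q : R, [/\ 0 <= C, 0 <= q < 1 & forall n x y, S x -> S y ->
    nrm (iter n F x - iter n F y) <= C * q ^+ n * nrm (x - y)].
Proof.
move=> B0 d0 FD FS SD DB conv.
have SsubD x : S x -> D x.
  by move=> Sx; apply: (SD x) => //; rewrite subrr nrm0 ltW.
have B1 : 0 < 2 * B + 1 by lra.
(* Two points of [D] are at most [2 B] apart, so the stretch moves a point of [S] by at most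
   [t (2 B) <= d] and stays in [D]. *)
pose t := d / (2 * B + 1); have t0 : 0 < t by rewrite divr_gt0.
have tB : t * (2 * B) <= d.
  by rewrite /t mulrAC ler_pdivrMr // ler_wpM2l ?(ltW d0) //; lra.
have q0 : 0 < (1 + t)^-1 by rewrite invr_gt0; lra.
have q1 : (1 + t)^-1 < 1 by rewrite invf_lt1; lra.
have C0 : 0 <= 8 * B / d by rewrite divr_ge0 ?mulr_ge0 // ltW.
exists (8 * B / d), (1 + t)^-1; split=> //; first by rewrite (ltW q0).
have iterS n x : S x -> S (iter n F x).
  by move=> Sx; elim: n => //= n /SsubD/FS.
have deriv n x : S x -> exists2 L, fder (iter n F) x L &
    forall v, nrm (L v) <= 8 * B / d * (1 + t)^-1 ^+ n * nrm v.
  move=> Sx; pose H := fix H n y := if n is m.+1 then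
    F (H m y) + t%:C%C *: (F (H m y) - iter m.+1 F x) else y.
  have HD k y : D y -> D (H k y).
    elim: k => //= k IH /IH Hy; apply: (SD (F (H k y))); first exact: FS.
    rewrite [F _ + _]addrC addrK nrmZr ?(ltW t0) //.
    apply: le_trans tB; rewrite ler_wpM2l ?(ltW t0) //.
    apply: (le_trans (nrmB _ _)).
    have := DB _ (SsubD _ (FS _ Hy)).
    by have := DB _ (SsubD _ (iterS k.+1 x Sx)) => /=; lra.
  have Hx k : H k x = iter k F x.
    by elim: k => //= k ->; rewrite subrr scaler0 addr0.
  have HdD k y : D y -> exists L, fder (H k) y L.
    move=> Dy; elim: k => [|k [L IH]]; first by exists id; exact: fder_id.
    have [M FM] := FD _ (HD k y Dy).
    by eexists; apply: fder_stretch; apply: fder_comp IH FM.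
  (* By linearity the factors [1 + t] gather in front of one derivative [L] of the iterate, so that
     a bound for [H n] becomes a decaying bound for [L]. *)
  have [L FL HL] : exists2 L, fder (iter n F) x L &
      fder (H n) x (fun v => (1 + t%:C%C) ^+ n *: L v).
    elim: n => [|n [L IH1 IH2]].
      exists id; first exact: fder_id.
      rewrite (_ : (fun v => _) = id); first exact: fder_id.
      by apply/funext => v; rewrite expr0 scale1r.
    have [M FM] := FD _ (SsubD _ (iterS n x Sx)).
    exists (fun v => M (L v)); first exact: fder_comp IH1 FM.
    rewrite (_ : (fun v => _) = (fun v => (1 + t%:C%C) *: M ((1 + t%:C%C) ^+ n *: L v))).
      apply: (@fder_stretch _ _ (fun y => F (H n y)) x (fun v => M ((1 + t%:C%C) ^+ n *: L v))).
      by apply: (fder_comp IH2); rewrite Hx.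
    have [linM _ _] := FM.
    by apply/funext => v; rewrite (linZ linM) scalerA -exprS.
  exists L => // v.
  have bd y : nrm (y - x) <= d -> D y by exact: SD.
  have := @cauchy_fder _ _ (H n) x _ B d d0 _ _ HL v.
  rewrite nrmZ cabsX.
  have -> : cabs (1 + t%:C%C) = 1 + t.
    by rewrite -(rmorph1 (real_complex R)) -rmorphD cabs_real ger0_norm; lra.
  have tn : 0 < (1 + t) ^+ n by rewrite exprn_gt0; lra.
  move=> Hc; rewrite exprVn mulrAC -ler_pdivrMr ?invr_gt0 // invrK mulrC.
  by apply: Hc => y /bd => [/HdD|/(HD n)/DB].
move=> n x y Sx Sy; rewrite nrm_subC [nrm (x - y)]nrm_subC.
apply: mean_value_fder; first by rewrite mulr_ge0 // exprn_ge0 // ltW.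
by move=> s s01; apply: deriv; exact: conv.
Qed.

(** * The map [F] and its fixed point *)

Section FixedPoint.
Variables (R : realType) (A : completeNormedModType R[i]).
Variables (mul : A -> A -> A) (one : A) (star : A -> A).
Hypothesis HA : unital_cstar_algebra mul one star.
Variable eta : A -> A.
Hypothesis eta_maps : forall W, Aplus mul one star W -> Aplus mul one star (eta W).
Hypothesis eta_holo : forall W, Aplus mul one star W -> differentiable eta W.
Hypothesis eta_bdd : forall r : R, 0 < r -> exists M : R, forall W,
  Aplus mul one star W -> nrm W <= r -> nrm (eta W) <= M.
Variable V : A.
Hypothesis HV : Aplus mul one star V.

Local Notation acc := (acc one).
Local Notation inv := (is_inverse mul one).
Local Notation Ap := (Aplus mul one star).
Local Notation F := (fun W => ainv mul one (V + eta W)).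
Local Notation rho := (nrm (ainv mul one (ReA star V))).

Lemma nrm_inv_gt0 a b : inv a b -> 0 < nrm b.
Proof.
move=> [ab _]; rewrite nrm_gt0; apply/eqP => b0; move: ab.
by rewrite b0 (cmulr0 HA) => /esym/eqP; rewrite (negPf (cs_one_neq0 HA)).
Qed.

Lemma acc_convex W W' e (s : R) : acc W e -> acc W' e -> 0 <= s <= 1 ->
  acc (W + s%:C%C *: (W' - W)) e.
Proof.
move=> We We' /andP[s0 s1].
have [->|sn0] := eqVneq s 0; first by rewrite scale0r addr0.
have [->|sn1] := eqVneq s 1; first by rewrite scale1r subrKC.
have -> : W + s%:C%C *: (W' - W) = (1 - s)%:C%C *: W + s%:C%C *: W'.
  by rewrite scalerBr rmorphB rmorph1 scalerBl scale1r addrA addrAC.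
rewrite (_ : e = (1 - s) * e + s * e); last by ring.
apply: acc_add; apply: acc_scale => //; first by rewrite subr_gt0 lt_neqAle sn1.
by rewrite lt0r sn0.
Qed.

(** The given bound [e] of [Re V] improves to [1 / rho]: for [e <= r < 1 / rho], [Re V - r] is a
    perturbation of [Re V] small against its inverse. *)
Lemma rho_acc : 0 < rho /\ acc V rho^-1.
Proof.
have [e e0 Ve] := (AplusP HA V).1 HV.
have [y yi _] := acc_inv HA e0 (acc_Re HA Ve).
rewrite (ainvE HA yi); have y0 := nrm_inv_gt0 yi; split => //.
apply/(cge_acc HA); apply: (sa_cge HA (star_ReA HA V)) => r ry.
have [re|er] := ltP r e.
  have [||z zi _] := @acc_inv _ _ _ _ _ HA (ReA star V - r%:C%C *: one) (e - r).
  - by rewrite subr_gt0.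
  - exact: (acc_shift HA) (acc_Re HA Ve).
  by exists z.
have [|z zi _] := @inv_perturb _ _ _ _ _ HA _ _ (r%:C%C *: one) yi; last by exists z.
by rewrite (nrm_real HA) ger0_norm ?(le_trans (ltW e0)) // -ltr_pdivlMr // mul1r.
Qed.

Lemma F_spec W : Ap W ->
  [/\ inv (V + eta W) (F W), 0 < nrm (V + eta W), nrm (F W) <= rho &
      acc (F W) (rho^-1 / nrm (V + eta W) ^+ 2)].
Proof.
move=> /eta_maps/(AplusP HA)[e e0 We]; have [r0 Vr] := rho_acc.
have U : acc (V + eta W) rho^-1.
  by rewrite -[rho^-1]addr0; apply: acc_add => //; apply: acc_le We; exact: ltW.
have ri : 0 < rho^-1 by rewrite invr_gt0.
have [y yi yn] := acc_inv HA ri U.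
rewrite (ainvE HA yi); split => //.
- exact: nrm_inv_gt0 (inv_sym yi).
- by rewrite invrK in yn.
- exact: (acc_inverse HA ri U yi).
Qed.

Lemma F_Aplus W : Ap W -> Ap (F W).
Proof.
move=> /F_spec[_ U0 _ FW]; apply/(AplusP HA); exists (rho^-1 / nrm (V + eta W) ^+ 2) => //.
by have [r0 _] := rho_acc; rewrite divr_gt0 ?invr_gt0 ?exprn_gt0.
Qed.

Lemma F_fder W : Ap W -> exists L, fder F W L.
Proof.
move=> HW; have [L etaL] := differentiable_fder (eta_holo HW).
have [Ui _ _ _] := F_spec HW.
by eexists; apply: (fder_comp (fder_addl V etaL) (fder_ainv HA Ui)).
Qed.

Lemma F_contracts (r : R) : rho < r ->
  exists S : A -> Prop, exists C q d : R,
  [/\ 0 <= C, 0 <= q < 1 & 0 < d] /\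
  [/\ forall W, Ap W -> nrm W < r -> S (F W),
      forall W, S W -> nrm W <= rho,
      forall W W', S W -> nrm (W' - W) <= d -> Ap W' /\ nrm W' < r &
      forall n W W', S W -> S W' ->
        nrm (iter n F W - iter n F W') <= C * q ^+ n * nrm (W - W')].
Proof.
move=> rr; have [r0 Vr] := rho_acc.
have [M HM] := eta_bdd (lt_trans r0 rr).
pose m := nrm V + `|M| + 1; have m0 : 0 < m by rewrite ltr_wpDl // addr_ge0 ?nrm_ge0.
pose de := rho^-1 / m ^+ 2.
have de0 : 0 < de by rewrite divr_gt0 ?invr_gt0 ?exprn_gt0.
(* The two terms of [d] guard the two ways of leaving the domain: losing the lower bound on the real
   part, and reaching norm [r]. *)
pose S W := acc W de /\ nrm W <= rho; pose d := Num.min (de / 2) ((r - rho) / 2).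
have d0 : 0 < d by rewrite lt_min divr_gt0 //= divr_gt0 // subr_gt0.
have FS W : Ap W -> nrm W < r -> S (F W).
  move=> HW Wr; have [_ U0 Fr FW] := F_spec HW; split => //.
  apply: acc_le FW; rewrite ler_wpM2l ?invr_ge0 ?(ltW r0) //.
  rewrite lef_pV2 ?posrE ?exprn_gt0 //; apply: le_sqr; first exact: ltW.
  apply: (le_trans (nrmD _ _)); have := HM W HW (ltW Wr).
  by have := ler_norm M; rewrite /m; lra.
have SD W W' : S W -> nrm (W' - W) <= d -> Ap W' /\ nrm W' < r.
  move=> [We Wr]; rewrite le_min => /andP[H1 H2]; split.
    apply/(AplusP HA); exists (de - de / 2); first lra.
    rewrite -(subrKC W W'); apply: acc_add => //.
    exact: (acc_small HA).
  by have := nrmD (W' - W) W; rewrite subrK; lra.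
have [|||||C [q [C0 q01 H]]] := @earle_hamilton _ _ F
  (fun W => Ap W /\ nrm W < r) S r d (ltW (lt_trans r0 rr)) d0.
- by move=> W [/F_fder].
- by move=> W [HW Wr]; exact: FS.
- by move=> W W'; exact: SD.
- by move=> W [_ /ltW].
- move=> W W' s [We Wr] [We' Wr'] s01; split; first exact: acc_convex.
  have /andP[s0 s1] := s01.
  have -> : W + s%:C%C *: (W' - W) = (1 - s)%:C%C *: W + s%:C%C *: W'.
    by rewrite scalerBr rmorphB rmorph1 scalerBl scale1r addrA addrAC.
  apply: (le_trans (nrmD _ _)); rewrite !nrmZr ?subr_ge0 //.
  have s1' : 0 <= 1 - s by rewrite subr_ge0.
  by have := ler_wpM2l s0 Wr'; have := ler_wpM2l s1' Wr; lra.
by exists S, C, q, d; split => //; split => // W [].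
Qed.

(** With [r] above both norms, the two fixed points lie in [S] as their own images, and the distance
    of their iterates is constant yet tends to [0]. *)
Lemma fixed_unique W W' : Ap W -> Ap W' -> F W = W -> F W' = W' -> W = W'.
Proof.
move=> HW HW' FW FW'; pose r := nrm W + nrm W' + rho + 1.
have [r0 _] := rho_acc; have n0 := nrm_ge0 W; have n0' := nrm_ge0 W'.
have [|S [C [q [d [[C0 q01 d0] [FS _ _ H]]]]]] := @F_contracts r; first by rewrite /r; lra.
have SW : S W by rewrite -FW; apply: FS => //; rewrite /r; lra.
have SW' : S W' by rewrite -FW'; apply: FS => //; rewrite /r; lra.
have it X : F X = X -> forall n, iter n F X = X.
  by move=> FX; elim=> //= n ->.
apply: nrm_sub_small => e e0.
have [N HN] := geometric_small (C * nrm (W - W')) q01 e0.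
have := H N W W' SW SW'; rewrite !it // => /le_trans; apply.
by rewrite mulrAC; apply: ltW; exact: HN.
Qed.

Lemma iterates_converge W0 : Ap W0 -> exists W, [/\ Ap W, F W = W &
  forall e : R, 0 < e -> exists N, forall n, (N <= n)%N -> nrm (iter n F W0 - W) < e].
Proof.
move=> HW0; pose r := nrm W0 + rho + 1.
have [r0 _] := rho_acc; have n0 := nrm_ge0 W0.
have [|S [C [q [d [[C0 q01 d0] [FS Sr SD H]]]]]] := @F_contracts r; first by rewrite /r; lra.
have SS W : S W -> S (F W).
  move=> SW; have [|HW Wr] := SD W W SW; first by rewrite subrr nrm0 ltW.
  exact: FS.
have S1 : S (F W0) by apply: FS => //; rewrite /r; lra.
(* [W0] may lie outside [S], so the sequence starts at its image. *)
pose u n := iter n F (F W0).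
have uS n : S (u n) by elim: n => //= n; exact: SS.
have [||W uW] := @geometric_steps _ _ u (C * (2 * rho)) q _ q01.
- by rewrite !mulr_ge0 // ltW.
- move=> n; rewrite /u -[iter n.+1 F _]/(F (iter n F _)) -iterS iterSr.
  apply: (le_trans (H n _ _ (SS _ S1) S1)).
  rewrite mulrAC ler_wpM2r ?exprn_ge0 //; first by case/andP: q01.
  rewrite ler_wpM2l //; apply: (le_trans (nrmB _ _)).
  by have := Sr _ S1; have := Sr _ (SS _ S1); lra.
have [N HN] := uW d d0.
(* A limit of points of A_+ may leave A_+; this one stays, being within [d] of a point of [S]. *)
have [HW Wr] : Ap W /\ nrm W < r.
  by apply: (SD _ _ (uS N)); rewrite nrm_subC ltW // HN.
exists W; split => //.
  have [L FL] := F_fder HW; apply: nrm_sub_small => e e0.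
  have [|d1 d10 Hd1] := fder_continuous FL (_ : 0 < e / 2); first by rewrite divr_gt0.
  have [N1 HN1] := uW d1 d10.
  have [|N2 HN2] := uW (e / 2); first by rewrite divr_gt0.
  pose n := (N1 + N2)%N.
  have A1 := Hd1 _ (HN1 n (leq_addr _ _)).
  have A2 := HN2 n.+1 (leq_trans (leq_addl _ _) (leqnSn _)).
  have := nrmD (F W - F (u n)) (u n.+1 - W).
  rewrite -[u n.+1]/(F (u n)) subrKA nrm_subC in A1 A2 *; lra.
move=> e /uW[N1 HN1]; exists N1.+1 => -[//|n]; rewrite ltnS iterSr.
exact: HN1.
Qed.

End FixedPoint.

Unset Implicit Arguments.

Theorem theorem1 (R : realType) (A : completeNormedModType R[i])
  (mul : A -> A -> A) (one : A) (star : A -> A)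
  (HA : unital_cstar_algebra mul one star)
  (eta : A -> A)
  (eta_maps : forall W, Aplus mul one star W -> Aplus mul one star (eta W))
  (eta_holo : forall W, Aplus mul one star W -> differentiable eta W)
  (eta_bdd : forall r : R, 0 < r -> exists M : R, forall W,
      Aplus mul one star W -> nrm W <= r -> nrm (eta W) <= M)
  (V : A) (HV : Aplus mul one star V) :
  let F := fun W => ainv mul one (V + eta W) in
  let rho := nrm (ainv mul one (ReA star V)) in
  let m := nrm V + sup [set nrm (eta W') | W' in
                          [set W' | Aplus mul one star W' /\ nrm W' <= rho]] in
  exists W : A,
    [/\ Aplus mul one star W,
        mul V W + mul (eta W) W = one,
        (forall W', Aplus mul one star W' ->
            mul V W' + mul (eta W') W' = one -> W' = W),
        (forall W0, Aplus mul one star W0 ->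
            (forall n, Aplus mul one star (iter n F W0) /\
                       invertible mul one (V + eta (iter n F W0))) /\
            (fun n => iter n F W0) @ \oo --> W) &
      (nrm W <= rho /\
        cge mul one star (ReA star W) (((m ^+ 2 * rho)^-1)%:C%C *: one))].
Proof.
move=> F rho m.
have spec := F_spec HA eta_maps HV.
have [rho0 _] := rho_acc HA HV.
have Aone : Aplus mul one star one.
  by apply/(AplusP HA); exists 1 => //; rewrite -[X in acc _ X]scale1r; exact: (acc_real HA).
have [W [HW FW _]] := iterates_converge HA eta_maps eta_holo eta_bdd HV Aone.
have [Wi U0 Wr Wacc] := spec W HW; rewrite FW in Wi Wr Wacc.
exists W; split => //.
- by rewrite -(cs_mulDl HA) Wi.1.
- move=> W' HW' W'eq; apply: (fixed_unique HA eta_maps eta_holo eta_bdd HV) => //.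
  (* A solution is a right inverse of [V + eta W']; multiplying by the two-sided inverse [F W']
     shows that it is a fixed point. *)
  have [[_ iU] _ _ _] := spec W' HW'.
  have : mul (mul (F W') (V + eta W')) W' = F W'.
    by rewrite -(cs_mulA HA) (cs_mulDl HA) W'eq (cs_mul1r HA).
  by rewrite iU (cs_mul1l HA).
- move=> W0 HW0; split.
    have Hn n : Aplus mul one star (iter n F W0).
      by elim: n => //= n; exact: (F_Aplus HA eta_maps HV).
    by move=> n; split => //; have [Ui _ _ _] := spec _ (Hn n); exists (F (iter n F W0)).
  have [W1 [HW1 FW1 conv]] := iterates_converge HA eta_maps eta_holo eta_bdd HV HW0.
  rewrite (fixed_unique HA eta_maps eta_holo eta_bdd HV HW HW1 FW FW1).
  exact: cvg_nrmP.
split => //; apply/(cge_acc HA); apply: acc_le Wacc.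
(* [|W| <= rho] puts [eta W] among the elements of the supremum, which is finite by [eta_bdd] at
   [rho]. *)
have Um : nrm (V + eta W) <= m.
  apply: (le_trans (nrmD _ _)); rewrite lerD2l; apply: ub_le_sup.
    by have [M HM] := eta_bdd rho rho0; exists M => _ [W' [HW' W'r] <-]; exact: HM.
  by exists W.
have m0 : 0 < m := lt_le_trans U0 Um.
rewrite invfM mulrC ler_wpM2l ?invr_ge0 ?(ltW rho0) //.
by rewrite lef_pV2 ?posrE ?exprn_gt0 //; apply: le_sqr => //; exact: ltW.
Qed.
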